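(* There is a randomized algorithm (Algorithm Conn) in the Congested Clique model that, on every $n$-vertex input graph $G=(V,E)$, solves the Connectivity Verification problem in $O(\log\log\log n)$ rounds with probability at least $1-\frac1n$.
   Context: Congested Clique model: there are $n$ nodes with distinct IDs (each representable in $O(\log n)$ bits), forming the vertex set $V$; computation proceeds in synchronous rounds; in each round every node may perform arbitrary local computation (with private randomness) and send a possibly different message of $O(\log n)$ bits to each of the other $n-1$ nodes. The input graph $G=(V,E)$ is on the same node set $V$. Connectivity Verification problem: initially each node $v\in V$ knows the edges of $E$ incident to it. When the algorithm ends, all nodes of $V$ are required to know a maximal spanning forest of $G$ (and hence can decide whether $G$ is connected). A maximal spanning forest of $G$ is a spanning forest of $G$ having exactly as many trees as $G$ has connected components. *)

(* Defs.v *)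
From HB Require Import structures.
From mathcomp Require Import all_boot all_order all_algebra.
From mathcomp Require Import boolp reals topology normedtype sequences landau exp.
Set Implicit Arguments.
Unset Strict Implicit.
Unset Printing Implicit Defensive.

Import Order.TTheory GRing.Theory Num.Theory.
Import numFieldNormedType.Exports.

Local Open Scope ring_scope.

Section Graphs.
Variable V : finType.
Implicit Types E F : {set {set V}}.

Definition simple_graph E : Prop := forall e, e \in E -> #|e| = 2%N.

Definition adj E : rel V := [rel u v | [set u; v] \in E].

Definition acyclic F : Prop :=
  forall p : seq V, (2 < size p)%N -> ~ ucycle (adj F) p.

(* A set [F] of edges stands for the spanning subgraph [(V, F)]; when it is
   acyclic, its connected components are its trees. *)
Definition spanning_forest E F : Prop := F \subset E /\ acyclic F.

Definition maximal_spanning_forest E F : Prop :=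
  spanning_forest E F /\ n_comp (adj F) predT = n_comp (adj E) predT.

End Graphs.

(* In an [n]-node network, identifiers are [idlen n]-bit strings and messages
   are [bandwidth n]-bit strings. A node starts from its own identifier, the
   incident edges of the input graph (as pairs of identifiers) and a private
   string of [coins n] random bits; these bits, drawn once and for all, also
   serve the later rounds. [send s x] is the message that a node in state [s]
   sends to the node with identifier [x], and [recv] is given the messages of
   the other nodes, each tagged with the identifier of its sender. *)
Record cc_algorithm (idlen : nat -> nat) : Type := CCAlgorithm {
  bandwidth : nat -> nat;
  coins : nat -> nat;
  state : nat -> Type;
  init : forall n, (idlen n).-tuple bool -> {set {set (idlen n).-tuple bool}} ->
    (coins n).-tuple bool -> state n;
  send : forall n, state n -> (idlen n).-tuple bool ->
    (bandwidth n).-tuple bool;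
  recv : forall n, state n ->
    {set (idlen n).-tuple bool * (bandwidth n).-tuple bool} -> state n;
  output : forall n, state n -> {set {set (idlen n).-tuple bool}}
}.

Section Execution.
Variables (idlen : nat -> nat) (A : cc_algorithm idlen) (V : finType).
Variables (ident : V -> (idlen #|V|).-tuple bool) (E : {set {set V}}).

Definition incident_edges (v : V) : {set {set V}} := [set e in E | v \in e].

Definition edge_ids (F : {set {set V}}) : {set {set (idlen #|V|).-tuple bool}} :=
  [set ident @: e | e : {set V} in F].

Definition inbox (s : V -> state A #|V|) (v : V) :
    {set (idlen #|V|).-tuple bool * (bandwidth A #|V|).-tuple bool} :=
  [set (ident u, send (s u) (ident v)) | u in [set~ v]].

Definition randomness : finType := {ffun V -> (coins A #|V|).-tuple bool}.

Fixpoint config (r : randomness) (t : nat) : V -> state A #|V| :=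
  if t is t'.+1 then fun v => recv (config r t' v) (inbox (config r t') v)
  else fun v => init (ident v) (edge_ids (incident_edges v)) (r v).

Definition solves_connectivity (T : nat) (r : randomness) : Prop :=
  exists F : {set {set V}}, maximal_spanning_forest E F /\
    forall v, output (config r T v) = edge_ids F.

End Execution.

Definition uniform_prob (R : realType) (W : finType) (P : W -> Prop) : R :=
  #|[pred w | `[< P w >]]|%:R / #|W|%:R.

(* Main.v *)
(** All nodes maintain the same set of known edges of [G], whose
    components are called clusters.  In three rounds, every node of a cluster
    [C] learns, for each neighbouring cluster, one edge leading to it (all nodes
    of [C] learn the same edges), and the [|C|] nodes of [C] broadcast [|C|] of
    these edges.  A cluster which still is not a whole component of [G] then has
    grown from size at least [s] to size at least [s * (s + 1)], so that
    O(log log log n) such phases yield size polylog(n).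

    The components are then found by Boruvka's algorithm run on random linear
    sketches of cuts: for a set [U] of vertices, the sum in characteristic 2 of
    random labels over randomly sampled edges incident to the vertices of [U] is
    the sum over the sampled edges of the cut of [U], and it identifies an edge
    of the cut when exactly one is sampled.  A sketch consists of polylog(n) words
    of O(log n) bits, hence the nodes of a cluster can share the work: the [i]-th
    node collects and broadcasts the [i]-th word of the sketch of the cluster.

    The labels need far more random bits than a node can distribute.  But as there are
    only 2^poly(n) inputs, there is a fixed table of poly(n) random choices in
    which for every input only few choices fail, and an index into that table fits
    in one message. *)
Require Import Defs.
From HB Require Import structures.
From mathcomp Require Import all_boot all_order all_algebra.
From mathcomp Require Import boolp reals topology normedtype sequences landau exp.
From mathcomp Require Import zify ring lra.
Set Implicit Arguments.
Unset Strict Implicit.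
Unset Printing Implicit Defensive.

Import Order.TTheory GRing.Theory Num.Theory.
Import numFieldNormedType.Exports.

(** * Components and cuts *)

Section Components.
Variable V : finType.
Implicit Types (E F G H : {set {set V}}) (A : {set V}) (x y u v : V).

Definition comp F x : {set V} := [set y | connect (adj F) x y].

Definition cut E A : {set {set V}} := [set e in E | #|e :&: A| == 1%N].

Definition open_comp E F x := cut E (comp F x) != set0.

Lemma adj_sym F : symmetric (adj F).
Proof. by move=> x y; rewrite /adj /= setUC. Qed.

Lemma adj_connect_sym F : connect_sym (adj F).
Proof. exact/sym_connect_sym/adj_sym. Qed.

Lemma connect_adjS F G : F \subset G -> subrel (connect (adj F)) (connect (adj G)).
Proof.
move=> /subsetP FG; apply: connect_sub => x y xy; apply: connect1; exact: FG.
Qed.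

Lemma mem_comp F x : x \in comp F x.
Proof. by rewrite inE connect0. Qed.

Lemma eq_comp F x y : (comp F x == comp F y) = connect (adj F) x y.
Proof.
apply/eqP/idP => [/setP/(_ y)|xy]; first by rewrite !inE connect0.
by apply/setP=> z; rewrite !inE (same_connect (@adj_connect_sym F) xy).
Qed.

Lemma compS F G x : F \subset G -> comp F x \subset comp G x.
Proof. by move=> FG; apply/subsetP=> y; rewrite !inE; apply: connect_adjS. Qed.

Lemma mem_comp_sub F G x y : F \subset G -> y \in comp G x -> comp F y \subset comp G x.
Proof.
move=> FG; rewrite inE -eq_comp => /eqP->; exact: compS.
Qed.

Lemma mem_cut E A u v : [set u; v] \in E -> u \in A -> v \notin A -> [set u; v] \in cut E A.
Proof.
move=> uvE uA vA; rewrite inE uvE; apply/cards1P; exists u.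
apply/setP => x; rewrite !inE; apply/andP/eqP => [[/orP[]/eqP->]|->] //.
  by move=> vA'; rewrite vA' in vA.
by rewrite eqxx.
Qed.

Lemma cut_edge E A e : simple_graph E -> e \in cut E A ->
  exists u v, [/\ e = [set u; v], e \in E, u \in A & v \notin A].
Proof.
move=> sE; rewrite inE => /andP[eE /cards1P[u eA]].
have /setIP[ue uA] : u \in e :&: A by rewrite eA inE.
have /cards2P[a [b [ab eab]]] : #|e| == 2%N by apply/eqP; exact: sE.
have [v [ev vu]] : exists v, e = [set u; v] /\ v != u.
  move: ue; rewrite eab !inE => /orP[] /eqP->.
    by exists b; split => //; rewrite eq_sym.
  by exists a; rewrite setUC.
exists u, v; split => //; apply: contra vu => vA.
by rewrite -in_set1 -eA inE vA ev !inE eqxx orbT.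
Qed.

Lemma cutP E A : simple_graph E ->
  reflect (exists u v, [/\ [set u; v] \in E, u \in A & v \notin A]) (cut E A != set0).
Proof.
move=> sE; apply: (iffP (set0Pn _)) => [[e /(cut_edge sE)]|].
  by move=> [u [v [-> uvE uA vA]]]; exists u, v.
by move=> [u [v [uvE uA vA]]]; exists [set u; v]; apply: mem_cut.
Qed.

Lemma open_compP E F x : simple_graph E ->
  reflect (exists u v, [/\ [set u; v] \in E, connect (adj F) x u & ~~ connect (adj F) x v])
          (open_comp E F x).
Proof.
move=> sE; apply: (iffP (cutP _ sE)) => -[u [v H]]; exists u, v; by move: H; rewrite !inE.
Qed.

Lemma open_comp_eq E F x y : connect (adj F) x y -> open_comp E F x = open_comp E F y.
Proof. by rewrite -eq_comp /open_comp => /eqP->. Qed.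

Lemma open_comp_edge E F u v : simple_graph E -> [set u; v] \in E ->
  ~~ connect (adj F) u v -> open_comp E F u && open_comp E F v.
Proof.
move=> sE uvE uv; apply/andP; split; apply/open_compP => //.
  by exists u, v; rewrite connect0.
by exists v, u; rewrite connect0 setUC adj_connect_sym.
Qed.

(** Followed from [y], the path in [G] never leaves the [F]-component of [y]: its edges lie in [E],
    and no edge of [E] crosses the boundary of that component. *)
Lemma closed_comp_sub E F G x y : simple_graph E -> G \subset E ->
  connect (adj G) x y -> ~~ open_comp E F y -> connect (adj F) x y.
Proof.
move=> sE GE xy oy; rewrite adj_connect_sym.
move: xy; rewrite adj_connect_sym => /connectP[p].
elim/last_ind: p x => [|p z IH] x /=; first by move=> _ ->; rewrite connect0.
rewrite rcons_path last_rcons => /andP[/IH/(_ erefl) yp pz ->].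
apply/negPn/negP=> yz; case/negP: oy; apply/open_compP => //.
by exists (last y p), z; split => //; apply: (subsetP GE).
Qed.

Lemma closed_connect E F : simple_graph E -> F \subset E ->
  (forall x, ~~ open_comp E F x) -> connect (adj F) =2 connect (adj E).
Proof.
move=> sE FE cl x y; apply/idP/idP; first exact: connect_adjS.
by move/(closed_comp_sub sE (subxx E))/(_ (cl _)).
Qed.

(** The [F]-components of the points of [A] are pairwise disjoint and lie in [comp G x]. Both growth
    arguments, for phases and for Boruvka steps, count in this way. *)
Lemma card_comp_ge F G x s A : F \subset G ->
  A \subset comp G x -> {in A &, injective (comp F)} ->
  (forall y, y \in A -> s <= #|comp F y|)%N -> (#|A| * s <= #|comp G x|)%N.
Proof.
move=> FG /subsetP Ax injA As.
rewrite -sum_nat_const.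
apply: (@leq_trans (\sum_(y in A) #|comp F y|)); first exact: leq_sum.
have /eqP tI : trivIset [set comp F y | y in A].
  apply/trivIsetP => B C /imsetP[y _ ->] /imsetP[z _ ->]; apply: contraR.
  case/pred0Pn => t /andP[]; rewrite /= !inE eq_comp => yt; rewrite (adj_connect_sym _ z).
  exact: connect_trans.
rewrite -(big_imset (fun B : {set V} => #|B|) injA) /= tI.
apply/subset_leq_card/subsetP => z /bigcupP[_ /imsetP[y yA ->]].
by apply/subsetP; apply: mem_comp_sub (Ax _ yA).
Qed.

(** * Spanning forests *)

Definition same_components E F := connect (adj F) =2 connect (adj E).

Definition spanning E F := `[< [/\ F \subset E, acyclic F & same_components E F] >].

Lemma connect_remove_edge F a b :
  connect (adj (F :\ [set a; b])) a b -> same_components F (F :\ [set a; b]).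
Proof.
move=> ab x y; apply/idP/idP; first by apply: connect_adjS; exact: subD1set.
apply: connect_sub => {}x {}y; rewrite /adj /= => xyF.
have [e|ne] := eqVneq [set x; y] [set a; b]; last first.
  by apply: connect1; rewrite /adj /= !inE ne.
have := set21 x y; have := set22 x y; rewrite e !inE.
have ba : connect (adj (F :\ [set a; b])) b a by rewrite adj_connect_sym.
by case/orP=> /eqP-> /orP[] /eqP->.
Qed.

(** An inclusion-minimal subset of [E] with the same components has no cycle, as an edge of a cycle
    could be removed. *)
Lemma spanning_exists E : exists F, spanning E F.
Proof.
pose P F := (F \subset E) && `[< same_components E F >].
have [|F /minsetP[/andP[FE /asboolP cF] minF]] := @ex_minset _ P.
  by exists E; rewrite /P subxx; apply/asboolP.
exists F; apply/asboolP; split => // -[//|a p] sp /andP[cyc up].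
(* The edge to remove closes the cycle from [b] back to [a]; the path [p] still joins them. A length
   above 2 makes the first vertex of [p] differ from [b], so that [p] avoids the removed edge. *)
pose b := last a p.
have abF : [set a; b] \in F.
  by move: cyc; rewrite /= rcons_path => /andP[_]; rewrite /adj /= setUC.
have ab : connect (adj (F :\ [set a; b])) a b.
  move: cyc; rewrite /= rcons_path => /andP[pp _].
  apply/connectP; exists p => //.
  case: p @b sp up pp {abF} => [//|c p] b sp up /= /andP[ac pp].
  have bp : b \in c :: p by rewrite /b /= mem_last.
  have nb : c != b.
    case: p {bp} @b sp up pp => [//|d p] b _ /= /and3P[_ cp _] _.
    by apply: contraNneq cp => ->; rewrite /b /= mem_last.
  have na : a \notin c :: p by case/andP: up.
  have ca : c != a by apply: contraNneq na => <-; rewrite mem_head.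
  apply/andP; split.
    move: ac; rewrite /adj /= !inE => ->; rewrite andbT.
    apply/eqP => e; have := set22 a c; rewrite e !inE; by rewrite (negbTE nb) (negbTE ca).
  apply: (sub_in_path (P := [in c :: p])) pp; last exact/allP.
  move=> u v up' vp; rewrite /adj /= !inE => ->.
  rewrite andbT; apply/eqP => e; have := set21 a b; rewrite -e !inE.
  by case/orP=> /eqP ea; rewrite ea ?up' ?vp in na.
have := minF (F :\ [set a; b]); rewrite subD1set => H.
suff : F :\ [set a; b] = F by move/setP/(_ [set a; b]); rewrite !inE eqxx abF.
apply: H => //; apply/andP; split; first exact: subset_trans (subD1set _ _) FE.
by apply/asboolP => x y; rewrite (connect_remove_edge ab) cF.
Qed.

End Components.

(** * Uniform measure on finite types *)

Local Open Scope ring_scope.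

Section UniformMeasure.

Definition mu (T : finType) (A : pred T) : rat := #|A|%:R / #|T|%:R.

Lemma le_mu (T : finType) (A B : pred T) : subpred A B -> mu A <= mu B.
Proof.
move=> AB; rewrite /mu ler_wpM2r ?invr_ge0 ?ler0n // ler_nat.
by apply/subset_leq_card/subsetP => x; apply: AB.
Qed.

Lemma mu_exists (T I : finType) (A : I -> pred T) :
  mu [pred t | [exists i, A i t]] <= \sum_i mu (A i).
Proof.
rewrite /mu -mulr_suml ler_wpM2r ?invr_ge0 ?ler0n // -natr_sum ler_nat.
rewrite -sum1_card big_mkcond.
under [X in (_ <= X)%N]eq_bigr => i _ do rewrite -sum1_card big_mkcond.
rewrite exchange_big /=; apply: leq_sum => t _; rewrite inE.
case: existsP => // -[i Ai]; rewrite (bigD1 i) //= [_ \in _]Ai; lia.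
Qed.

Lemma mu_orb (T : finType) (A B : pred T) : mu [predU A & B] <= mu A + mu B.
Proof.
rewrite /mu -mulrDl ler_wpM2r ?invr_ge0 ?ler0n // -natrD ler_nat.
by rewrite -cardUI leq_addr.
Qed.

Variables (I T : finType).
Implicit Types (w : {ffun I -> T}).

Definition resample w i a : {ffun I -> T} := [ffun j => if j == i then a else w j].

(* Exchanging the [i]-th coordinate of [w] with an independent draw is a
   measure-preserving involution. *)
Lemma mu_resample i (P : {ffun I -> T} -> pred T) (c : rat) :
  (0 < #|T|)%N -> (forall w a, P (resample w i a) =1 P w) -> (forall w, mu (P w) <= c) ->
  mu [pred w | P w (w i)] <= c.
Proof.
move=> T0 Pi Pc; rewrite /mu.
have N0 : (0 < #|{ffun I -> T}|)%N by rewrite card_ffun expn_gt0 T0.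
rewrite ler_pdivrMr ?ltr0n //.
rewrite -(ler_pM2r (x := #|T|%:R)) ?ltr0n //.
have -> : #|[pred w | P w (w i)]|%:R * #|T|%:R = \sum_w #|P w|%:R :> rat.
  rewrite -natrM -natr_sum; congr (_%:R).
  rewrite -sum1_card big_mkcond big_distrl /=.
  under eq_bigr => w _ do rewrite (mulnC _ #|_|) -sum_nat_const.
  under [RHS]eq_bigr => w _ do rewrite -sum1_card big_mkcond.
  rewrite !pair_big /=.
  pose f (p : {ffun I -> T} * T) := (resample p.1 i p.2, p.1 i).
  have fK : involutive f.
    move=> [w a]; rewrite /f /= ffunE eqxx; congr pair.
    by apply/ffunP => j; rewrite !ffunE; case: eqP => // ->.
  rewrite (reindex_inj (inv_inj fK)) /=; apply: eq_bigr => -[w a] _ /=.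
  by rewrite !inE /= ffunE eqxx unfold_in Pi.
apply: (@le_trans _ _ (\sum_(w : {ffun I -> T}) c * #|T|%:R)).
  by apply: ler_sum => w _; rewrite -ler_pdivrMr ?ltr0n //; exact: Pc.
by rewrite sumr_const -mulr_natr; lra.
Qed.

End UniformMeasure.

Local Close Scope ring_scope.

(** * Linear sketches *)

Local Open Scope ring_scope.

Section MuFamily.
Variables (I T : finType).

Lemma mu_family (F : I -> pred T) : (0 < #|T|)%N ->
  mu [pred w : {ffun I -> T} | [forall i, F i (w i)]] = \prod_i mu (F i).
Proof.
move=> T0; rewrite /mu big_split /= prodfV; congr (_ / _).
  rewrite -natr_prod; congr (_%:R).
  rewrite (eq_card (B := family F)) => [|w]; first by rewrite card_family foldrE big_image.
  by rewrite inE.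
by rewrite card_ffun natrX prodr_const.
Qed.

Lemma mu_predC (A : pred T) : (0 < #|T|)%N -> mu (predC A) = 1 - mu A.
Proof.
move=> T0; apply: (@mulIf _ #|T|%:R); first by rewrite pnatr_eq0 -lt0n.
rewrite mulrBl /mu !divfK ?pnatr_eq0 -?lt0n //.
by rewrite mul1r -(cardC A) natrD; lra.
Qed.

Lemma mu_coord (i : I) (A : pred T) : (0 < #|T|)%N ->
  mu [pred w : {ffun I -> T} | A (w i)] <= mu A.
Proof. by move=> T0; exact: (mu_resample (P := fun=> A)). Qed.

End MuFamily.

Lemma bernoulli (q : rat) n : 0 <= q <= 1 -> 1 - n%:R * q <= (1 - q) ^+ n.
Proof.
move=> /andP[q0 q1]; elim: n => [|n IH]; first by rewrite expr0; lra.
rewrite exprS.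
apply: le_trans (ler_wpM2l (_ : 0 <= 1 - q) IH); last by lra.
rewrite -natr1; have : 0 <= n%:R * (q * q) by rewrite mulr_ge0 ?ler0n // mulr_ge0.
by nra.
Qed.

(** Sampling [N] elements at rate [2 ^ l / 2 ^ h.+1] then keeps between 1/4 and 1/2 of an element on
    average. *)
Lemma sampling_level h N : (0 < N <= 2 ^ h)%N ->
  exists2 l, (l <= h)%N & (N * 2 ^ l <= 2 ^ h < N * 2 ^ l.+1)%N.
Proof.
move=> /andP[N0 Nh].
have q0 : (0 < 2 ^ h %/ N)%N by rewrite divn_gt0.
exists (trunc_log 2 (2 ^ h %/ N)).
  have := trunc_logP (isT : 1 < 2)%N q0 => le.
  rewrite -(@leq_exp2l 2) //; apply: leq_trans le _; exact: leq_div.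
rewrite mulnC -leq_divRL // trunc_logP //=.
by rewrite mulnC -ltn_divLR // trunc_log_ltn.
Qed.

Section Sampling.
Variables (X : finType) (h w : nat).

Definition word := 'rV['F_2]_w.
(** A single number decides the selection at all levels at once; its range [2 ^ h.+1] keeps the rate
    of each level [l <= h] at most 1/2. The word is the random label. *)
Definition draw : finType := ('I_(2 ^ h.+1) * word)%type.
Implicit Types (f : {ffun X -> draw}) (D : {set X}) (e : X) (l : nat).

Definition selected l (t : draw) := (t.1 < 2 ^ l)%N.

Definition sketch f l D : word := \sum_(e in D | selected l (f e)) (f e).2.

Definition isolates f l D e :=
  (e \in D) && [forall e', (e' \in D) ==> (selected l (f e') == (e' == e))].

Lemma card_word : #|{: word}| = (2 ^ w)%N.
Proof. by rewrite card_mx card_Fp // mul1n. Qed.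

Lemma draw_gt0 : (0 < #|{: draw}|)%N.
Proof. by rewrite card_prod card_ord card_word muln_gt0 !expn_gt0. Qed.

Lemma sketch_isolates f l D e : isolates f l D e -> sketch f l D = (f e).2.
Proof.
case/andP=> eD /forallP /= H; rewrite /sketch (bigD1 e) /=; last first.
  by rewrite eD /=; have := H e; rewrite eD eqxx => /eqP.
rewrite big1 ?addr0 // => e' /andP[/andP[e'D s] ne].
by have := H e'; rewrite e'D s (negbTE ne).
Qed.

Lemma mu_selected l : (l <= h.+1)%N -> mu (selected l) = 2 ^+ l / 2 ^+ h.+1.
Proof.
move=> lh; rewrite /mu.
have -> : #|selected l| = (2 ^ l * 2 ^ w)%N.
  have -> : #|selected l| = #|setX [set i : 'I_(2 ^ h.+1) | i < 2 ^ l]%N [set: word]|.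
    by rewrite -cardsE; apply: eq_card => -[i v]; rewrite !inE andbT.
  rewrite cardsX cardsT card_word; congr (_ * _)%N.
  have le2 : (2 ^ l <= 2 ^ h.+1)%N by rewrite leq_pexp2l.
  have inj : injective (widen_ord le2) by move=> i j /(congr1 val) /= /val_inj.
  rewrite -[RHS]card_ord -(card_imset _ inj).
  apply: eq_card => i; rewrite !inE; apply/idP/imsetP => [il|[j _ ->]].
    by exists (Ordinal il) => //; apply: val_inj.
  exact: ltn_ord j.
rewrite card_prod card_ord card_word !natrM !natrX.
by field; rewrite !expf_neq0 ?pnatr_eq0.
Qed.

(** With [N = #|D|] and rate [q], the disjoint events of isolating a given element add up to
    [N * q * (1 - q) ^ (N - 1)]. Here [N * q >= 1/4], and the power is at least 1/2 by Bernoulli's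
    inequality. *)
Lemma mu_isolates D : (0 < #|D| <= 2 ^ h)%N ->
  exists2 l, (l <= h)%N & 1 / 8 <= mu [pred f | [exists e, isolates f l D e]].
Proof.
move=> /[dup] Dh /sampling_level[l lh /andP[Nl Nl1]].
exists l; first by [].
set q : rat := 2 ^+ l / 2 ^+ h.+1.
have h0 : 0 < 2 ^+ h :> rat by rewrite exprn_gt0.
have qE : q * (2 * 2 ^+ h) = 2 ^+ l.
  by rewrite -exprS divfK // expf_neq0 // pnatr_eq0.
have q0 : 0 < q by rewrite divr_gt0 // exprn_gt0.
have [Nq1 Nq2] : #|D|%:R * q <= 1 / 2 /\ 1 / 4 <= #|D|%:R * q.
  move: Nl (ltnW Nl1); rewrite -!(ler_nat rat) !natrM !natrX exprS -qE.
  move: (2 ^+ h) (#|D|%:R) h0 => b N b0 Nl Nl2.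
  by split; rewrite -(ler_pM2r b0); lra.
have N1 : 1 <= #|D|%:R :> rat by rewrite ler1n; case/andP: Dh.
have q1 : q <= 1 / 2 by nra.
have mu1 e : e \in D -> mu [pred f | isolates f l D e] = q * (1 - q) ^+ #|D|.-1.
  move=> eD.
  pose F e' : pred draw :=
    if e' == e then selected l else if e' \in D then predC (selected l) else predT.
  have -> : mu [pred f | isolates f l D e] =
      mu [pred f : {ffun X -> draw} | [forall e', F e' (f e')]].
    congr (_%:R / _); apply: eq_card => f; rewrite !inE /isolates eD /=.
    apply: eq_forallb => e'; rewrite /F.
    have [->|ne] := eqVneq e' e; first by rewrite eD /= eqb_id.
    by case: (e' \in D) => //=; rewrite eqbF_neg.
  rewrite mu_family ?draw_gt0 // (bigD1 e) //= {1}/F eqxx mu_selected ?leqW //.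
  congr (_ * _); rewrite (bigID [in D]) /= [X in _ * X]big1 ?mulr1; last first.
    move=> e' /andP[/negbTE ne /negbTE e'D]; rewrite /F ne e'D /mu divff //.
    by rewrite pnatr_eq0 -lt0n draw_gt0.
  rewrite (eq_bigr (fun=> 1 - q)) => [|e' /andP[/negbTE ne e'D]]; last first.
    by rewrite /F ne e'D mu_predC ?draw_gt0 // mu_selected ?leqW.
  rewrite prodr_const; congr (_ ^+ _); rewrite (cardsD1 e D) eD /=.
  by apply: eq_card => e'; rewrite !inE.
have -> : mu [pred f | [exists e, isolates f l D e]] =
    \sum_(e in D) mu [pred f | isolates f l D e].
  rewrite /mu -mulr_suml -natr_sum; congr (_%:R / _).
  rewrite -sum1_card big_mkcond /=.
  under [RHS]eq_bigr => e _ do rewrite -sum1_card big_mkcond.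
  rewrite exchange_big /=; apply: eq_bigr => f _; rewrite inE.
  case: existsP => [[e fe]|nex]; last first.
    by rewrite big1 // => e eD; rewrite inE; case: ifP => // fe; case: nex; exists e.
  have eD : e \in D by case/andP: fe.
  rewrite (bigD1 e) //= inE fe big1 // => e' /andP[e'D ne]; rewrite inE.
  case: ifP => // fe'; case/andP: fe => _ /forallP/(_ e'); case/andP: fe' => _ /forallP/(_ e').
  by rewrite e'D eqxx (negbTE ne) /= => /eqP->.
rewrite (eq_bigr _ mu1) sumr_const -[leRHS]mulr_natl mulrA.
have := @bernoulli q #|D|.-1; rewrite (ltW q0) => /(_ _) B.
have {}B : 1 / 2 <= (1 - q) ^+ #|D|.-1.
  apply: le_trans (B _); last by lra.
  have : #|D|.-1%:R <= #|D|%:R :> rat by rewrite ler_nat leq_pred.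
  by nra.
by nra.
Qed.

(** The draw of [e] does not enter the sketch of [D], so the label of [e] is uniform and independent
    of it. *)
Lemma mu_collision l D e : e \notin D ->
  mu [pred f : {ffun X -> draw} | (f e).2 == sketch f l D] <= (2 ^+ w)^-1.
Proof.
move=> eD; apply: (mu_resample (P := fun f t => t.2 == sketch f l D)); first exact: draw_gt0.
  move=> f a t /=; congr (_ == _); rewrite /sketch big_mkcondr [RHS]big_mkcondr.
  apply: eq_bigr => e' e'D; rewrite ffunE; case: eqP => // ee.
  by rewrite -ee e'D in eD.
move=> f; rewrite /mu.
have -> : #|(fun t : draw => t.2 == sketch f l D)| = (2 ^ h.+1)%N.
  transitivity #|setX [set: 'I_(2 ^ h.+1)] [set sketch f l D]|; last first.
    by rewrite cardsX cardsT card_ord cards1 muln1.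
  by apply: eq_card => -[i v]; rewrite !inE.
rewrite card_prod card_ord card_word natrM !natrX.
by rewrite invfM mulrA divff ?mul1r // expf_neq0 // pnatr_eq0.
Qed.

Variable reps : nat.
Definition draws : finType := {ffun 'I_reps -> {ffun X -> draw}}.
Implicit Types (g : draws) (K : {set X}).

Definition sketches g D (j : 'I_reps * 'I_h.+1) : word := sketch (g j.1) j.2 D.

Definition decode g K (z : 'I_reps * 'I_h.+1 -> word) : option X :=
  [pick e in K | [exists j, (g j.1 e).2 == z j]].

Definition decodes g K D :=
  if decode g K (sketches g D) is Some e then e \in D else D == set0.

(** Decoding fails only if the label of some element outside [D] equals one of the [reps * h.+1]
    readings, or if no repetition isolates an element of a nonempty [D]. The latter is bounded at
    the one good level, where each repetition misses with probability at most 7/8. *)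
Lemma mu_not_decodes K D : D \subset K -> (#|K| <= 2 ^ h)%N ->
  mu [pred g | ~~ decodes g K D] <=
    (reps * h.+1 * #|K|)%:R / 2 ^+ w + (7 / 8) ^+ reps.
Proof.
move=> DK Kh.
pose coll (c : 'I_reps * 'I_h.+1 * X) : pred draws :=
  [pred g : draws | (c.2 \in K :\: D) && ((g c.1.1 c.2).2 == sketch (g c.1.1) c.1.2 D)].
pose miss : pred draws := [pred g : draws | (D != set0) &&
  [forall i, forall l : 'I_h.+1, forall e, ~~ isolates (g i) l D e]].
have sub : subpred [pred g | ~~ decodes g K D] [predU [pred g | [exists c, coll c g]] & miss].
  move=> g /=; rewrite /decodes /decode.
  case: pickP => [e /andP[eK /existsP[j je]] eD|none D0].
    apply/orP; left; apply/existsP; exists (j, e).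
    by rewrite /coll /= inE eD eK /=.
  apply/orP; right; rewrite /miss /= D0 /=.
  apply/forallP => i; apply/forallP => l; apply/forallP => e; apply/negP => ie.
  have eD : e \in D by case/andP: ie.
  have := none e; rewrite (subsetP DK _ eD) /= => /existsP[]; exists (i, l).
  by rewrite /sketches /= (sketch_isolates ie).
apply: le_trans (le_mu sub) _; apply: le_trans (mu_orb _ _) _; apply: lerD.
  apply: le_trans (mu_exists _) _.
  apply: (@le_trans _ _ (\sum_(c : 'I_reps * 'I_h.+1 * X | c.2 \in K) (2 ^+ w)^-1)).
    rewrite [leRHS]big_mkcond; apply: ler_sum => -[[i l] e] _ /=.
    have [eKD|eKD] := boolP (e \in K :\: D); last first.
      have -> : mu (coll (i, l, e)) = 0.
        by rewrite /mu eq_card0 ?mul0r // => g; rewrite inE /= (negbTE eKD).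
      by case: ifP => // _; rewrite invr_ge0 exprn_ge0.
    move: (eKD); rewrite inE => /andP[eD ->].
    apply: le_trans (mu_collision l eD).
    apply: le_trans (mu_coord i [pred f : {ffun X -> draw} | (f e).2 == sketch f l D] _).
      by apply: le_mu => g /= /andP[].
    by rewrite card_ffun expn_gt0 draw_gt0.
  rewrite sumr_const -[leLHS]mulr_natl; apply: ler_wpM2r; first by rewrite invr_ge0 exprn_ge0.
  rewrite ler_nat (eq_card (B := [in setX [set: 'I_reps * 'I_h.+1] K])) => [|c]; last first.
    by case: c => c e; rewrite in_setX in_setT.
  by rewrite cardsX cardsT card_prod !card_ord.
have [D0|D0] := eqVneq D set0.
  rewrite /mu eq_card0 => [|g]; last by rewrite inE /= D0 eqxx.
  by rewrite mul0r; apply: exprn_ge0; rewrite divr_ge0.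
have [l lh lP] : exists2 l, (l <= h)%N & 1 / 8 <= mu [pred f | [exists e, isolates f l D e]].
  by apply: mu_isolates; rewrite card_gt0 D0 (leq_trans (subset_leq_card DK)).
have ffun0 : (0 < #|{ffun X -> draw}|)%N by rewrite card_ffun expn_gt0 draw_gt0.
pose F (i : 'I_reps) : pred {ffun X -> draw} := predC [pred f | [exists e, isolates f l D e]].
apply: (@le_trans _ _ (mu [pred g : draws | [forall i, F i (g i)]])).
  apply: le_mu => g /= /andP[_ /forallP H]; apply/forallP => i /=.
  by rewrite /F /= negb_exists; move/forallP: (H i) => /(_ (Ordinal (lh : l < h.+1)%N)).
rewrite (mu_family F ffun0) /F prodr_const card_ord; apply: lerXn2r.
- by rewrite nnegrE /mu divr_ge0.
- by rewrite nnegrE divr_ge0.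
- by rewrite mu_predC //; lra.
Qed.

End Sampling.

Local Close Scope ring_scope.

(** * Derandomization *)

Lemma leq_expn2r m n e : (m <= n -> m ^ e <= n ^ e)%N.
Proof. by case: e => [|e] mn; rewrite ?expn0 // leq_exp2r. Qed.

Lemma expn_succ_half h : ((2 * h).+1 ^ h <= 2 * (2 * h) ^ h)%N.
Proof.
(* This is Bernoulli's inequality for [1 - 1 / (2 * h + 1)] with denominators cleared; at [i = h]
   the resulting ratio [(2 * h + 1) / (h + 1)] is below 2. *)
have H i : (i <= h -> (2 * h).+1 ^ i * ((2 * h).+1 - i) <= (2 * h) ^ i * (2 * h).+1)%N.
  elim: i => [|i IH] ih; first by rewrite !expn0 subn0.
  rewrite !expnS -[X in (_ <= X)%N]mulnA.
  apply: leq_trans (leq_mul (leqnn _) (IH (ltnW ih))).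
  rewrite mulnAC [X in (_ <= X)%N]mulnCA [X in (X <= _)%N]mulnC leq_mul2l.
  by apply/orP; right; nia.
have := H h (leqnn h).
have := expn_gt0 (2 * h) h.
move: (_ ^ h)%N (_ ^ h)%N => a b _; nia.
Qed.

Lemma expn_succ_le4 h : ((2 * h).+1 ^ (2 * h) <= 4 * (2 * h) ^ (2 * h))%N.
Proof.
have := expn_succ_half h; rewrite (mulnC 2 h) !expnM (mulnC h 2) => H.
by rewrite (_ : 4 = 2 ^ 2)%N // -expnMn leq_exp2r.
Qed.

Section Derandomize.
Variables (X W S : finType) (xs : {set X}) (bad : X -> pred W) (M h : nat).

(* For a random table [f], the expectation of [2 ^ cnt f x] is at most [4 ^ M],
   while [cnt f x >= 4 * M] would make it at least [16 ^ M]. *)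
Lemma derandomize : (0 < h)%N -> (0 < #|W|)%N -> #|S| = (2 * h * M)%N ->
  (#|xs| < 4 ^ M)%N -> (forall x, x \in xs -> #|bad x| * (2 * h) <= #|W|)%N ->
  exists f : {ffun S -> W}, forall x, x \in xs ->
    (#|[pred s | bad x (f s)]| < 4 * M)%N.
Proof.
move=> h0 W0 cS cxs badW.
pose cnt (f : {ffun S -> W}) x := #|[pred s | bad x (f s)]|.
have [/existsP[f /forall_inP fP]|] := boolP [exists f, [forall x in xs, cnt f x < 4 * M]%N].
  by exists f.
rewrite negb_exists => /forallP bad_all; exfalso.
have lower : (#|W| ^ #|S| * 4 ^ M * 4 ^ M <= \sum_f \sum_(x in xs) 2 ^ cnt f x)%N.
  rewrite -card_ffun -mulnA -sum_nat_const; apply: leq_sum => f _.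
  have /forall_inPn[x xxs] := bad_all f; rewrite -leqNgt => le.
  rewrite (bigD1 x) //= -expnD; apply: leq_trans (leq_addr _ _).
  by rewrite (_ : 4 = 2 ^ 2)%N // -expnM leq_pexp2l //; lia.
have upper x : x \in xs -> (\sum_f 2 ^ cnt f x <= #|W| ^ #|S| * 4 ^ M)%N.
  move=> xxs.
  (* The weight [2 ^ cnt f x] is a product over the entries of the table, so its sum over all tables
     factors. *)
  have -> : (\sum_f 2 ^ cnt f x = (#|W| + #|bad x|) ^ #|S|)%N.
    transitivity (\prod_(s : S) \sum_(v : W) (if bad x v then 2 else 1))%N; last first.
      rewrite prod_nat_const; congr (_ ^ _)%N.
      rewrite (eq_bigr (fun v => 1 + (if bad x v then 1 else 0)))%N => [|v _];
        last by case: ifP.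
      by rewrite big_split /= -big_mkcond !sum1_card.
    rewrite bigA_distr_bigA; apply: eq_bigr => f _.
    by rewrite -big_mkcond /= prod_nat_const; congr (_ ^ _)%N; apply: eq_card.
  have p0 : (0 < (2 * h) ^ #|S|)%N by rewrite expn_gt0; lia.
  rewrite -(leq_pmul2r p0) -expnMn.
  apply: (@leq_trans ((#|W| * (2 * h).+1) ^ #|S|)).
    by apply: leq_expn2r; have := badW x xxs; lia.
  rewrite expnMn -mulnA leq_mul2l; apply/orP; right.
  rewrite cS !(expnM _ (2 * h)) -expnMn.
  exact/leq_expn2r/expn_succ_le4.
have := leq_trans lower; rewrite exchange_big /= => /(_ _ (leq_sum _ upper)).
rewrite sum_nat_const mulnC leq_mul2r leqNgt cxs orbF muln_eq0 !expn_eq0.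
by rewrite eqn0Ngt W0.
Qed.

End Derandomize.

(** * Boruvka's algorithm on sketches *)

Section Boruvka.
Variables (V : finType) (h w reps R : nat).
Implicit Types (E F G : {set {set V}}) (U : {set V}).

Definition pairs : {set {set V}} := [set e : {set V} | #|e| == 2%N].

Notation draws := (draws {set V} h w reps).

Definition seeds : finType := {ffun 'I_R -> draws}.

Definition readings := 'I_R -> {set V} -> 'I_reps * 'I_h.+1 -> word w.

Implicit Types (g : seeds) (z : readings).

(** The readings are a parameter so that the same procedure applies to true cut sketches and to
    words gathered from the network. Each step consumes its own seed; beyond [R] steps nothing
    changes. *)
Fixpoint boruvka g z F (n : nat) : {set {set V}} :=
  if n is n'.+1 then
    let G := boruvka g z F n' in
    if insub n' is Some r then
      G :|: [set e | [exists x, decode (g r) pairs (z r (comp G x)) == Some e]]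
    else G
  else F.

Definition cut_readings E g : readings := fun r U => sketches (g r) (cut E U).

Lemma boruvka_sub g z F n : F \subset boruvka g z F n.
Proof.
elim: n => [|n IH] //=; case: insub => // r.
by apply: subset_trans IH _; exact: subsetUl.
Qed.

(** The known edges only grow from [F], so only unions of components of [F] are ever queried. *)
Lemma eq_boruvka g z z' F n :
  (forall r U, (forall x, x \in U -> comp F x \subset U) -> z r U =1 z' r U) ->
  boruvka g z F n = boruvka g z' F n.
Proof.
move=> zz; elim: n => [|n IH]; first by [].
rewrite /= -IH; case: insub => [r|]; last by [].
apply: (congr1 (setU _)); apply/setP => e; rewrite !inE; apply: eq_existsb => x.
rewrite /decode (eq_pick (Q := fun e => (e \in pairs) && [exists j,
  (g r j.1 e).2 == z' r (comp (boruvka g z F n) x) j])) // => e'.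
congr (_ && _); apply: eq_existsb => j; rewrite zz // => y.
exact/mem_comp_sub/boruvka_sub.
Qed.

Definition boruvka_ok E F g := [forall r : 'I_R, forall x,
  decodes (g r) pairs (cut E (comp (boruvka g (cut_readings E g) F r) x))].

(** The first [n] steps read only seeds of index below [n]. Seed [r] is thus independent of the
    components it has to treat. *)
Lemma boruvka_resample E F g (r : 'I_R) a n : n <= r ->
  boruvka (resample g r a) (cut_readings E (resample g r a)) F n =
  boruvka g (cut_readings E g) F n.
Proof.
elim: n => [|n IH] nr; first by [].
rewrite /= (IH (ltnW nr)); case: insubP => [i _ iE|_]; last by [].
have ir : (i == r) = false by apply/eqP => ir; rewrite -ir iE ltnn in nr.
by rewrite /cut_readings /sketches ffunE ir.
Qed.

Local Open Scope ring_scope.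

(** Union bound over steps and vertices. Once the other seeds are fixed, the cut queried in step [r]
    is fixed too, and the bound for a single decoding applies to seed [r]. *)
Lemma mu_not_boruvka_ok E F : simple_graph E -> (#|pairs| <= 2 ^ h)%N ->
  mu [pred g | ~~ boruvka_ok E F g] <=
    (R * #|V|)%:R * ((reps * h.+1 * #|pairs|)%:R / 2 ^+ w + (7 / 8) ^+ reps).
Proof.
move=> sE ph; set c := (X in _ * X).
pose bad (p : 'I_R * V) : pred seeds := [pred g : seeds | ~~
  decodes (g p.1) pairs (cut E (comp (boruvka g (cut_readings E g) F p.1) p.2))].
apply: (@le_trans _ _ (mu [pred g | [exists p, bad p g]])).
  apply: le_mu => g /forallPn[r /forallPn[x H]].
  by apply/existsP; exists (r, x).
apply: le_trans (mu_exists _) _.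
have -> : (R * #|V|)%:R * c = \sum_(p : 'I_R * V) c.
  by rewrite sumr_const card_prod card_ord mulr_natl.
apply: ler_sum => -[r x] _.
apply: (mu_resample (i := r) (P := fun g t => ~~
  decodes t pairs (cut E (comp (boruvka g (cut_readings E g) F r) x)))).
- by rewrite !card_ffun !expn_gt0 draw_gt0.
- by move=> g a t /=; rewrite boruvka_resample.
- move=> g; apply: mu_not_decodes ph; apply/subsetP => e.
  by rewrite !inE => /andP[/sE-> _].
Qed.

Local Close Scope ring_scope.

Lemma boruvka_ok_sub E F g n : F \subset E -> boruvka_ok E F g ->
  boruvka g (cut_readings E g) F n \subset E.
Proof.
move=> FE /forallP ok; elim: n => [|n IH] //=; case: insubP => // r _ rn.
rewrite subUset IH; apply/subsetP => e; rewrite inE => /existsP[x /eqP dx].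
have /forallP/(_ x) := ok r; rewrite /decodes rn dx.
by rewrite inE => /andP[].
Qed.

(** A component still open after step [n] contains an endpoint [u] of a leaving edge, whose previous
    component was open as well. The edge decoded for [u] joins it to another previously open
    component, and the two disjoint sets have at least [2 ^ n] vertices each. *)
Lemma boruvka_large E F g n x : simple_graph E -> F \subset E -> boruvka_ok E F g ->
  n <= R -> open_comp E (boruvka g (cut_readings E g) F n) x ->
  2 ^ n <= #|comp (boruvka g (cut_readings E g) F n) x|.
Proof.
move=> sE FE ok; elim: n x => [|n IH] x nR.
  by move=> _; apply/card_gt0P; exists x; exact: mem_comp.
have GE := boruvka_ok_sub n FE ok; have G'E := boruvka_ok_sub n.+1 FE ok.
have GG' : boruvka g (cut_readings E g) F n \subset boruvka g (cut_readings E g) F n.+1.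
  by rewrite /=; case: insub => // r; exact: subsetUl.
move/(open_compP _ _ sE) => [u [v [uvE xu xv]]].
have nuv : ~~ connect (adj (boruvka g (cut_readings E g) F n)) u v.
  by apply: contra xv => uv; apply: connect_trans xu _; exact: connect_adjS GG' _ _ uv.
have /andP[ou _] := open_comp_edge sE uvE nuv.
have := ok => /forallP/(_ (Ordinal nR))/forallP/(_ u); rewrite /decodes -[nat_of_ord _]/n.
case eD: decode => [e|]; last by move: ou; rewrite /open_comp => /negbTE->.
move=> /(cut_edge sE)[a [b [eab eE]]]; rewrite !inE => ua ub.
have eG' : e \in boruvka g (cut_readings E g) F n.+1.
  rewrite /= insubT inE; apply/orP; right; rewrite inE; apply/existsP; exists u.
  by rewrite -eD; apply/eqP.
have nab : ~~ connect (adj (boruvka g (cut_readings E g) F n)) a b.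
  by apply: contra ub; apply: connect_trans.
have abE : [set a; b] \in E by rewrite -eab.
have /andP[_ ob] := open_comp_edge sE abE nab.
have neu : u != b by apply: contraNneq ub => <-.
have -> : 2 ^ n.+1 = #|[set u; b]| * 2 ^ n by rewrite cards2 neu expnS.
apply: (card_comp_ge GG').
- apply/subsetP => y; rewrite !inE => /orP[] /eqP-> //.
  apply: connect_trans xu (connect_trans (connect_adjS GG' ua) _).
  by apply: connect1; rewrite /adj /= -eab.
- move=> y y'; rewrite !inE => /orP[]/eqP-> /orP[]/eqP-> // /eqP; rewrite eq_comp.
    by rewrite (negbTE ub).
  by rewrite adj_connect_sym (negbTE ub).
- by move=> y; rewrite !inE => /orP[]/eqP->; apply: IH => //; exact: ltnW.
Qed.

Lemma boruvka_connect E F g : simple_graph E -> F \subset E -> #|V| < 2 ^ R ->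
  boruvka_ok E F g ->
  same_components E (boruvka g (cut_readings E g) F R).
Proof.
move=> sE FE VR ok; apply: closed_connect => //; first exact: boruvka_ok_sub.
move=> x; apply/negP => /(boruvka_large sE FE ok (leqnn R)) le.
by have := leq_trans VR le; rewrite ltnNge max_card.
Qed.

End Boruvka.

(** * Merging clusters *)

Section Phase.
Variable V : finType.
Implicit Types (E F : {set {set V}}) (v x y : V) (q : V -> option (V * V)).

Definition edge_to E F v x : option (V * V) :=
  [pick p | [&& p.1 == v, [set p.1; p.2] \in E & p.2 \in comp F x]].

Definition edge_among q F y : option (V * V) :=
  [pick p | [exists v in comp F y, q v == Some p]].

Definition neighbours q F y : seq V :=
  enum [pred r | [&& fingraph.root (adj F) r == r, r \notin comp F y & q r != None]].

Definition rank_in_comp F y : nat := index y (enum (comp F y)).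

(** The node of rank [i] takes care of the [i]-th neighbouring cluster. The default [y], met when
    the rank is too large, can only yield an edge inside the own cluster, which is harmless. *)
Definition assigned_edge q F y : option (V * V) :=
  q (nth y (neighbours q F y) (rank_in_comp F y)).

Definition edge_set q : {set {set V}} :=
  [set e | [exists y, exists p, (q y == Some p) && (e == [set p.1; p.2])]].

Definition edge_between E F y x := edge_among (fun v => edge_to E F v x) F y.

Definition broadcast_edge E F y := assigned_edge (edge_between E F y) F y.

Definition phase E F := F :|: edge_set (broadcast_edge E F).

Lemma edge_betweenP E F y x p : edge_between E F y x = Some p ->
  [/\ [set p.1; p.2] \in E, connect (adj F) y p.1 & connect (adj F) x p.2].
Proof.
rewrite /edge_between /edge_among; case: pickP => // p' /existsP[v] /andP[vy /eqP ev] [<-].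
move: ev; rewrite /edge_to; case: pickP => // p'' /and3P[/eqP pv pE px] [<-].
by move: vy px; rewrite !inE -pv.
Qed.

Lemma edge_between_some E F u v y x : [set u; v] \in E ->
  connect (adj F) y u -> connect (adj F) x v -> edge_between E F y x != None.
Proof.
move=> uvE yu xv; rewrite /edge_between /edge_among; case: pickP => // none.
case e: (edge_to E F u x) => [p|].
  by have /existsP[] := negbT (none p); exists u; rewrite inE yu e eqxx.
move: e; rewrite /edge_to; case: pickP => // /(_ (u, v)) /=.
by rewrite eqxx uvE inE xv.
Qed.

Lemma edge_between_comp E F y y' x : connect (adj F) y y' ->
  edge_between E F y x = edge_between E F y' x.
Proof. by rewrite -eq_comp /edge_between /edge_among => /eqP->. Qed.

Lemma neighbours_comp E F y y' : connect (adj F) y y' ->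
  neighbours (edge_between E F y) F y = neighbours (edge_between E F y') F y'.
Proof.
move=> yy'; apply: eq_enum => r; rewrite !inE (edge_between_comp _ _ yy').
by move: yy'; rewrite -eq_comp => /eqP/setP/(_ r); rewrite !inE => ->.
Qed.

Lemma phase_sup E F : F \subset phase E F.
Proof. exact: subsetUl. Qed.

Lemma phase_sub E F : F \subset E -> phase E F \subset E.
Proof.
move=> FE; rewrite subUset FE; apply/subsetP => e.
by rewrite inE => /existsP[y /existsP[p /andP[/eqP/edge_betweenP[pE _ _] /eqP->]]].
Qed.

(** All nodes of a cluster compute the same list of neighbours, so the member of rank [i] broadcasts
    precisely the edge leading to entry [i]. *)
Lemma phase_nth E F u i : let rs := neighbours (edge_between E F u) F u in
  i < size rs -> i < #|comp F u| -> connect (adj (phase E F)) u (nth u rs i).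
Proof.
move=> rs ir iC.
pose y := nth u (enum (comp F u)) i.
have yC : y \in comp F u by rewrite -mem_enum mem_nth // -cardE.
have uy : connect (adj F) u y by move: yC; rewrite inE.
have rk : rank_in_comp F y = i.
  move: uy; rewrite -eq_comp /rank_in_comp => /eqP <-.
  by rewrite /y index_uniq ?enum_uniq // -cardE.
have bE : broadcast_edge E F y = edge_between E F u (nth u rs i).
  rewrite /broadcast_edge /assigned_edge rk -(neighbours_comp E uy).
  by rewrite -(edge_between_comp _ _ uy) (set_nth_default u).
have : nth u rs i \in rs by rewrite mem_nth.
rewrite mem_enum inE => /and3P[_ _].
case e: edge_between => [p|] // _; have [pE up rp] := edge_betweenP e.
apply: connect_trans (connect_adjS (phase_sup E F) up) _.
apply: connect_trans (connect1 (y := p.2) _) _; last first.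
  by rewrite adj_connect_sym; apply: connect_adjS (phase_sup E F) _ _ rp.
rewrite /adj /= inE; apply/orP; right; rewrite inE; apply/existsP; exists y.
by apply/existsP; exists p; rewrite bE e !eqxx.
Qed.

(** If an edge [uv] still leaves the new component, the cluster of [v] was not joined, so the
    cluster of [u] has more neighbours than members. It therefore absorbs as many open clusters as
    it has members, which with itself makes at least [s + 1] clusters of size at least [s]. *)
Lemma phase_large E F s : simple_graph E ->
  (forall x, open_comp E F x -> s <= #|comp F x|) ->
  forall x, open_comp E (phase E F) x -> s * s.+1 <= #|comp (phase E F) x|.
Proof.
move=> sE large x /(open_compP _ _ sE)[u [v [uvE xu xv]]].
have nuv' : ~~ connect (adj (phase E F)) u v.
  by apply: contra xv; apply: connect_trans.
have nuv : ~~ connect (adj F) u v.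
  by apply: contra nuv'; apply: connect_adjS (phase_sup E F) _ _.
have /andP[ou ov] := open_comp_edge sE uvE nuv.
pose rs := neighbours (edge_between E F u) F u.
have symF := @adj_connect_sym _ F.
have vrs : fingraph.root (adj F) v \in rs.
  rewrite mem_enum inE root_root // eqxx /= inE.
  apply/andP; split.
    by apply: contra nuv => /connect_trans; apply; rewrite symF connect_root.
  by apply: edge_between_some uvE _ _ => //; rewrite symF connect_root.
have small : #|comp F u| < size rs.
  rewrite ltnNge; apply: contra nuv' => le.
  apply: (@connect_trans _ _ (fingraph.root (adj F) v)); last first.
    apply: connect_adjS (phase_sup E F) _ _ _; by rewrite symF connect_root.
  rewrite -(nth_index u vrs); apply: phase_nth; rewrite ?index_mem //.
  by apply: leq_trans le; rewrite index_mem.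
pose A := u |: [set r in take #|comp F u| rs].
have rsP r : r \in take #|comp F u| rs ->
    [/\ fingraph.root (adj F) r = r, ~~ connect (adj F) u r, open_comp E F r
      & connect (adj (phase E F)) u r].
  move=> /(nthP u)[i]; rewrite size_take_min => /[dup] ilt; rewrite leq_min => /andP[iC irs] e.
  have := mem_nth u irs; rewrite -(nth_take u iC) e mem_enum inE => /and3P[/eqP rr].
  rewrite inE => ur; case eb: edge_between => [p|] // _.
  have [pE up rp] := edge_betweenP eb; split=> //.
    have np : ~~ connect (adj F) p.1 p.2.
      apply: contra ur => pp; apply: connect_trans up (connect_trans pp _).
      by rewrite symF.
    have /andP[_] := open_comp_edge sE pE np.
    by rewrite (@open_comp_eq _ E F p.2 r) // symF.
  by rewrite -e nth_take //; apply: phase_nth.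
have cA : #|A| = #|comp F u|.+1.
  rewrite /A cardsU1 inE; have -> : u \notin take #|comp F u| rs.
    by apply/negP => /rsP[_]; rewrite connect0.
  rewrite cardsE; have /card_uniqP -> : uniq (take #|comp F u| rs).
    by rewrite take_uniq // enum_uniq.
  by rewrite size_takel // ltnW.
have le : s * s.+1 <= #|A| * s by rewrite cA mulnC leq_mul2r ltnS large // orbT.
apply: leq_trans le _; apply: (card_comp_ge (phase_sup E F)).
- apply/subsetP => r; rewrite !inE => /orP[/eqP->//|/rsP[_ _ _]].
  exact: connect_trans.
- move=> r r'; rewrite !inE => /orP[/eqP->|/rsP[rr ur _ _]] /orP[/eqP->|/rsP[rr' ur' _ _]] //;
    move=> /eqP; rewrite eq_comp ?(negbTE ur') //.
    by rewrite symF (negbTE ur).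
  by rewrite -(root_connect symF) rr rr' => /eqP.
- by move=> r; rewrite !inE => /orP[/eqP->|/rsP[_ _ ? _]]; exact: large.
Qed.

(** The first phase turns singletons into clusters of size 2; each later one at least squares the
    size, since [s * s.+1 >= s * s]. *)
Lemma phases_large E k : simple_graph E ->
  forall x, open_comp E (iter k.+1 (phase E) set0) x ->
  2 ^ (2 ^ k) <= #|comp (iter k.+1 (phase E) set0) x|.
Proof.
move=> sE; elim: k => [|k IH] x ox.
  rewrite expn0 expn1; apply: (phase_large (s := 1)) ox => // y _.
  by apply/card_gt0P; exists y; exact: mem_comp.
apply: leq_trans (phase_large sE IH ox).
by rewrite expnS mulnC muln2 -addnn expnD leq_mul.
Qed.

Lemma phases_sub E k : iter k (phase E) set0 \subset E.
Proof. by elim: k => [|k IH] /=; [exact: sub0set|exact: phase_sub]. Qed.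

End Phase.

(** * Distributed sketches *)

Section Aggregate.
Variables (V : finType) (h w reps R : nat).
Implicit Types (E F G : {set {set V}}) (U A : {set V}).

Local Open Scope ring_scope.

Definition incident E (v : V) : {set {set V}} := [set e in E | v \in e].

Lemma addww (z : word w) : z + z = 0.
Proof. by apply/matrixP => i j; rewrite !mxE -mulr2n -mulr_natl pchar_Fp_0 // mul0r. Qed.

(** An edge with both ends in [A] is counted twice and cancels in characteristic 2; an edge with one
    end in [A] is counted once. *)
Lemma sum_incident E A (f : {ffun {set V} -> draw h w}) l : simple_graph E ->
  \sum_(v in A) sketch f l (incident E v) = sketch f l (cut E A).
Proof.
move=> sE; rewrite /sketch.
rewrite (exchange_big_dep (fun e => (e \in E) && selected l (f e))) /=; last first.
  by move=> v e _; rewrite inE => /andP[/andP[-> _] ->].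
rewrite [RHS](eq_bigl (fun e => ((e \in E) && selected l (f e)) && (#|e :&: A| == 1%N)));
  last first.
  by move=> e; rewrite inE andbAC.
rewrite [RHS]big_mkcondr /=; apply: eq_bigr => e /andP[eE se].
rewrite (eq_bigl [in e :&: A]) => [|v]; last by rewrite !inE eE se /= andbT andbC.
rewrite sumr_const.
have := subset_leq_card (subsetIl e A); rewrite (sE _ eE).
by case: #|_| => [|[|[|n]]] // _; rewrite ?mulr0n ?mulr1n // mulr2n addww.
Qed.

(** The words for all [R] steps are numbered together, since they are transmitted at once, before
    any step is run. *)
Definition slots : finType := ('I_R * ('I_reps * 'I_h.+1))%type.

Implicit Types (g : seeds V h w reps R) (j : slots).

(** The sum has at most one term; it selects the word numbered [i] and gives 0 when [i] is not the
    number of a slot. *)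
Definition slot_word g E v i : word w :=
  \sum_(j : slots | enum_rank j == i :> nat) sketches (g j.1) (incident E v) j.2.

Definition comp_word g E F x : word w :=
  \sum_(v in comp F x) slot_word g E v (rank_in_comp F x).

Definition gather F (B : V -> word w) : readings V h w reps R :=
  fun r U q => \sum_(x in U | rank_in_comp F x == enum_rank ((r, q) : slots) :> nat) B x.

(* The slots beyond the size of a small component are never transmitted, but
   such a component has an empty cut, hence a null sketch. *)
Lemma gather_comp_word E F g r U : simple_graph E ->
  (forall x, open_comp E F x -> (#|slots| <= #|comp F x|)%N) ->
  (forall x, x \in U -> comp F x \subset U) ->
  gather F (comp_word g E F) r U =1 cut_readings E g r U.
Proof.
move=> sE large clU q; rewrite /gather /cut_readings /sketches.
set j := enum_rank _.
have sw v : slot_word g E v j = sketches (g r) (incident E v) q.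
  rewrite /slot_word (bigD1 (r, q)) //= big1 ?addr0 // => j'
    /andP[/eqP/val_inj/enum_rank_inj ->].
  by rewrite eqxx.
under eq_bigr => x /andP[_ /eqP xj] do rewrite /comp_word xj.
(* Only clusters with a node of rank [j] contribute to this slot, each through exactly one node; [A]
   is their union. *)
pose A := [set v in U | j < #|comp F v|]%N.
transitivity (\sum_(v in A) sketch (g r q.1) q.2 (incident E v)).
  rewrite (exchange_big_dep [in A]) /= => [|x v /andP[xU /eqP xj] vx]; last first.
    rewrite inE (subsetP (clU x xU)) //=.
    have /eqP <- : comp F x == comp F v by rewrite eq_comp; move: vx; rewrite inE.
    by rewrite -xj cardE index_mem mem_enum mem_comp.
  apply: eq_bigr => v; rewrite inE => /andP[vU jv].
  pose x0 := nth v (enum (comp F v)) j.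
  have x0v : x0 \in comp F v by rewrite -mem_enum mem_nth // -cardE.
  have xv : comp F x0 = comp F v by apply/esym/eqP; rewrite eq_comp; move: x0v; rewrite inE.
  rewrite (big_pred1 x0) ?sw // => x /=; apply/idP/eqP => [/andP[/andP[_ /eqP xj] vx]|->].
    have e : comp F x = comp F v by apply/eqP; rewrite eq_comp; move: vx; rewrite inE.
    by rewrite /x0 -xj /rank_in_comp e nth_index // mem_enum -e mem_comp.
  rewrite (subsetP (clU v vU)) //= xv mem_comp andbT /rank_in_comp xv /x0.
  by rewrite index_uniq ?enum_uniq // -cardE.
rewrite sum_incident //; congr sketch.
have sep u v : u \in A -> [set u; v] \in E -> v \notin A -> v \notin U.
  rewrite inE => /andP[uU ju] uvE; rewrite inE; apply: contra => vU; rewrite vU /=.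
  have [uv|uv] := boolP (connect (adj F) u v).
    by have /eqP <- : comp F u == comp F v by rewrite eq_comp.
  have /andP[_ /large] := open_comp_edge sE uvE uv; exact: leq_trans.
apply/setP => e; apply/idP/idP => /(cut_edge sE)[u [v [-> eE uA vA]]].
  by apply: mem_cut; rewrite ?(sep u) //; move: uA; rewrite inE => /andP[].
apply: mem_cut => //; last by apply: contra vA; rewrite inE => /andP[].
rewrite inE uA /=; have uv : ~~ connect (adj F) u v.
  by apply: contra vA => uv; apply: (subsetP (clU u uA)); rewrite inE.
have /andP[/large + _] := open_comp_edge sE eE uv; exact: leq_trans.
Qed.

End Aggregate.

(** * Synchronous programs *)

Section Rounds.
Variables (V : finType) (L M : Type).

Record round := Round {
  emit : L -> V -> M;
  absorb : L -> {ffun V -> option M} -> L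
}.

(** In the application [V] is the set of all identifiers and [S] the set of those carried by nodes;
    only the latter send messages. *)
Definition round_step (S : {set V}) (nodes : V -> L) (rd : round) : V -> L := fun x =>
  absorb rd (nodes x) [ffun y => if y \in S then Some (emit rd (nodes y) x) else None].

Definition run S := foldl (round_step S).

Lemma run_cat S nodes rds1 rds2 :
  run S nodes (rds1 ++ rds2) = run S (run S nodes rds1) rds2.
Proof. exact: foldl_cat. Qed.

End Rounds.

Section Compile.
Variables (idlen width coinlen : nat -> nat) (L : nat -> Type) (M : nat -> finType).

Local Notation ID n := ((idlen n).-tuple bool).

Variables (enc : forall n, M n -> (width n).-tuple bool)
  (dec : forall n, (width n).-tuple bool -> M n)
  (start : forall n, ID n -> {set {set ID n}} -> (coinlen n).-tuple bool -> L n)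
  (prog : forall n, seq (round (ID n) (L n) (M n)))
  (result : forall n, L n -> {set {set ID n}}).

Definition node n : Type := (ID n * seq (round (ID n) (L n) (M n)) * L n)%type.

Definition node_init n (x : ID n) edges coins : node n := (x, prog n, start x edges coins).

Definition node_send n (s : node n) (x : ID n) : (width n).-tuple bool :=
  if s.1.2 is rd :: _ then enc (emit rd s.2 x) else [tuple of nseq (width n) false].

(* A node does not receive its own message, but the rounds are described as if
   it did. *)
Definition node_recv n (s : node n) (box : {set ID n * (width n).-tuple bool}) : node n :=
  if s.1.2 is rd :: rds then
    (s.1.1, rds, absorb rd s.2 [ffun y => if y == s.1.1 then Some (emit rd s.2 y) else
       omap (fun p => dec p.2) [pick p in box | p.1 == y]])
  else s.

Definition compile : cc_algorithm idlen :=
  CCAlgorithm node_init node_send node_recv (fun n s => result s.2).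

(** By induction on the rounds already executed, with [rds2] those to come. Injectivity of [ident]
    makes the tag of a message determine its sender. *)
Lemma config_run (V : finType) (ident : V -> ID #|V|) (E : {set {set V}})
    (r : randomness compile V) (L0 : ID #|V| -> L #|V|) :
  (forall n, cancel (@enc n) (@dec n)) -> injective ident ->
  (forall v, L0 (ident v) = start (ident v) (edge_ids ident (incident_edges E v)) (r v)) ->
  forall rds1 rds2, prog #|V| = rds1 ++ rds2 -> forall v,
  config ident E r (size rds1) v =
    (ident v, rds2, run [set ident v | v : V] L0 rds1 (ident v)).
Proof.
move=> encK inj L0E; elim/last_ind => [|rds1 rd IH] rds2 progE v.
  by rewrite /= /node_init progE L0E.
rewrite size_rcons [config _ _ _ _.+1]/=.
have {}IH u := IH (rd :: rds2) _ u; rewrite -cats1 -catA in progE.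
rewrite /inbox; set box := [set _ | u in _].
have boxE : box = [set (ident u,
      enc (emit rd (run [set ident v | v : V] L0 rds1 (ident u)) (ident v)))
    | u in [set~ v]].
  by apply: eq_imset => u; rewrite IH.
rewrite {}boxE {box} IH // /node_recv /= /run foldl_rcons -/(run _) /round_step.
congr (_, _, absorb _ _ _); apply/ffunP => y; rewrite !ffunE.
case: eqVneq => [->|yv]; first by rewrite imset_f.
case: imsetP => [[u _ yu]|nS].
  have uv : u != v by apply: contraNneq yv => <-; rewrite yu.
  case: pickP => [p /andP[/imsetP[u' _ ->] /= /eqP]|].
    by rewrite yu => /inj ->; rewrite encK.
  move=> /(_ (ident u, enc (emit rd (run [set ident v | v : V] L0 rds1 (ident u)) (ident v)))).
  by rewrite /= yu eqxx andbT => /negP[]; apply/imsetP; exists u; rewrite ?inE.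
case: pickP => // p /andP[/imsetP[u _ ->] /= /eqP uy].
by case: nS; exists u.
Qed.

End Compile.

(** * The program of a node *)

Section Algorithm.
Variables (V C : finType) (h w reps R : nat) (seed_of : C -> seeds V h w reps R).
Implicit Types (E F : {set {set V}}) (S : {set V}) (x y : V).

Definition msg : finType := (option (V * V) * word w * C)%type.

Record local := Local {
  name : V;
  links : {set {set V}};
  tape : C;
  known : {set {set V}};
  mail : {ffun V -> option msg}
}.

Implicit Types (s : local) (m : {ffun V -> option msg}) (nodes : V -> local).

Definition mail_edge m y : option (V * V) := obind (fun a => a.1.1) (m y).
Definition mail_word m y : word w := oapp (fun a => a.1.2) 0%R (m y).

Definition say_edge s (e : option (V * V)) : msg := (e, 0%R, tape s).
Definition say_word s (z : word w) : msg := (None, z, tape s).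

(* The choice of the leader depends only on the set of senders, not on their
   coins, so that the coins of the leader are uniformly distributed. *)
Definition set_tape s m : local :=
  let c := if [pick y | m y != None] is Some y then oapp snd (tape s) (m y) else tape s in
  Local (name s) (links s) c (known s) m.

Definition set_mail s m : local := Local (name s) (links s) (tape s) (known s) m.

Definition add_known s m : local :=
  Local (name s) (links s) (tape s) (known s :|: edge_set (mail_edge m)) m.

Definition round_tape := Round (fun s _ => say_word s 0%R) set_tape.

Definition round_to :=
  Round (fun s x => say_edge s (edge_to (links s) (known s) (name s) x)) set_mail.

Definition round_among :=
  Round (fun s x => say_edge s (edge_among (mail_edge (mail s)) (known s) x)) set_mail.

Definition round_share :=
  Round (fun s _ => say_edge s (assigned_edge (mail_edge (mail s)) (known s) (name s))) add_known.

Definition round_slot := Round (fun s x =>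
  say_word s (slot_word (seed_of (tape s)) (links s) (name s) (rank_in_comp (known s) x))) set_mail.

Definition round_sum := Round (fun s _ =>
  say_word s (\sum_(v in comp (known s) (name s)) mail_word (mail s) v)%R) set_mail.

Definition program k : seq (round V local msg) :=
  round_tape :: flatten (nseq k [:: round_to; round_among; round_share])
    ++ [:: round_slot; round_sum].

Lemma size_program k : size (program k) = 3 * k + 3.
Proof.
rewrite /= size_cat size_flatten /shape map_nseq sumn_nseq /=; lia.
Qed.

(** The choice is a function of [G] alone, so nodes that compute the same [G] output the same
    forest. *)
Definition forest_of (G : {set {set V}}) := odflt set0 [pick F | spanning G F].

Definition conclude s := forest_of
  (boruvka (seed_of (tape s)) (gather (known s) (mail_word (mail s))) (known s) R).

Definition agree S E c F nodes := forall x, x \in S ->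
  [/\ name (nodes x) = x, links (nodes x) = incident E x, tape (nodes x) = c
    & known (nodes x) = F].

Section Run.
Variables (S : {set V}) (E : {set {set V}}).
Hypotheses (sE : simple_graph E) (ES : forall e, e \in E -> e \subset S).

(* Identifiers outside [S], which no node carries, are isolated vertices. *)
Lemma outside_connect F x y : F \subset E -> x \notin S -> connect (adj F) x y -> y = x.
Proof.
move=> FE xS /connectP[[|z p] //= /andP[xz _] _].
by have /subsetP/(_ x) := ES (subsetP FE _ xz); rewrite set21 (negbTE xS) => /(_ isT).
Qed.

Lemma edge_inside x y : [set x; y] \in E -> (x \in S) && (y \in S).
Proof. by move=> /ES/subsetP xyS; rewrite !xyS ?set21 ?set22. Qed.

Lemma eq_edge_among q q' F : q =1 q' -> edge_among q F =1 edge_among q' F.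
Proof.
by move=> qq y; apply: eq_pick => p; apply: eq_existsb => v; rewrite qq.
Qed.

Lemma eq_assigned_edge q q' F : q =1 q' -> assigned_edge q F =1 assigned_edge q' F.
Proof.
move=> qq y; rewrite /assigned_edge qq; congr (q' (nth _ _ _)).
by apply: eq_enum => r; rewrite !inE qq.
Qed.

(** The leader [x0] is fixed before the states are quantified, hence before any coins are drawn. *)
Lemma run_tape : S != set0 -> exists2 x0, x0 \in S & forall nodes,
  (forall x, x \in S -> [/\ name (nodes x) = x, links (nodes x) = incident E x
    & known (nodes x) = set0]) ->
  agree S E (tape (nodes x0)) set0 (run S nodes [:: round_tape]).
Proof.
case/set0Pn => x1 x1S.
case pE: [pick y in S] => [x0|]; last by move: pE; case: pickP => // /(_ x1); rewrite x1S.
have x0S : x0 \in S by move: pE; case: pickP => // ? ? [<-].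
exists x0 => // nodes init x xS; have [nx lx kx] := init x xS; split => //=.
rewrite (eq_pick (Q := [in S])) => [|y]; last by rewrite ffunE; case: ifP.
by rewrite pE ffunE x0S.
Qed.

(** The mail matches the global description even at silent identifiers outside [S]: no edge of [E]
    touches them, so the edge they would send is [None]. *)
Lemma run_phase c F nodes : F \subset E -> agree S E c F nodes ->
  agree S E c (phase E F) (run S nodes [:: round_to; round_among; round_share]).
Proof.
move=> FE ag /=;
 set nodes1 := round_step S nodes _; set nodes2 := round_step S nodes1 _.
have ag1 : agree S E c F nodes1 by move=> x /ag[]; split.
have m1 x : x \in S -> mail_edge (mail (nodes1 x)) =1 (fun v => edge_to E F v x).
  move=> xS y; rewrite /mail_edge ffunE; case: ifP => yS /=.
    have [-> -> _ ->] := ag y yS; apply: eq_pick => p; rewrite inE.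
    by case: eqVneq => //= <-; rewrite set21 andbT.
  rewrite /edge_to; case: pickP => //= p /and3P[/eqP py pE _].
  by have /andP[] := edge_inside pE; rewrite py yS.
have ag2 : agree S E c F nodes2 by move=> x /ag1[]; split.
have m2 x : x \in S -> mail_edge (mail (nodes2 x)) =1 edge_between E F x.
  move=> xS y; rewrite /mail_edge ffunE; case: ifP => yS /=.
    have [_ _ _ ->] := ag1 y yS; exact/eq_edge_among/m1.
  case e: edge_between => [p|] //; have [pE _ yp] := edge_betweenP e.
  have py := outside_connect FE (negbT yS) yp.
  by have /andP[_] := edge_inside pE; rewrite py yS.
move=> x xS; have [nx lx tx kx] := ag2 x xS; split => //=; rewrite kx.
congr (_ :|: _); apply/setP => e; rewrite !inE; apply: eq_existsb => y.
suff -> : mail_edge [ffun y => if y \in S then Some (emit round_share (nodes2 y) x)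
    else None] y = broadcast_edge E F y by [].
rewrite /mail_edge ffunE; case: ifP => yS /=.
  have [-> _ _ ->] := ag2 y yS; exact/eq_assigned_edge/m2.
rewrite /broadcast_edge /assigned_edge.
case eb: edge_between => [p|] //; have [pE yp _] := edge_betweenP eb.
have py := outside_connect FE (negbT yS) yp.
by have /andP[] := edge_inside pE; rewrite py yS.
Qed.

Lemma run_phases k c F nodes : F \subset E -> agree S E c F nodes ->
  agree S E c (iter k (phase E) F)
    (run S nodes (flatten (nseq k [:: round_to; round_among; round_share]))).
Proof.
elim: k F nodes => [|k IH] F nodes FE ag //.
rewrite iterSr /=; apply: (IH _ _ (phase_sub FE)).
exact: run_phase.
Qed.

Lemma run_words c F nodes : F \subset E -> agree S E c F nodes ->
  forall x, x \in S -> let s := run S nodes [:: round_slot; round_sum] x in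
  [/\ tape s = c, known s = F & mail_word (mail s) =1 comp_word (seed_of c) E F].
Proof.
move=> FE ag x xS; pose nodes1 := round_step S nodes round_slot.
have ag1 : agree S E c F nodes1 by move=> {x xS} x /ag[]; split.
have [_ _ tx kx] := ag1 x xS; split=> // y.
rewrite -[run _ _ _]/(round_step S nodes1 round_sum).
have no_links v : v \notin S -> incident E v = set0.
  move=> vS; apply/setP => e; rewrite !inE; apply/andP => -[eE ve].
  by move: vS; rewrite (subsetP (ES eE) _ ve).
have m1 z v : z \in S ->
    mail_word (mail (nodes1 z)) v = slot_word (seed_of c) E v (rank_in_comp F z).
  move=> zS; rewrite /mail_word ffunE; case: ifP => vS /=.
    have [-> -> -> ->] := ag v vS; rewrite /slot_word; apply: eq_bigr => j _.
    by congr sketches; apply/setP => e; rewrite !inE -andbA andbb.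
  rewrite /slot_word big1 // => j _; rewrite no_links ?vS // /sketches /sketch.
  by rewrite big1 // => e; rewrite inE.
rewrite /mail_word ffunE; case: ifP => yS /=.
  by have [-> _ _ ->] := ag1 y yS; rewrite /comp_word; apply: eq_bigr => v _; rewrite m1.
rewrite /comp_word big1 // => v; rewrite inE => /(outside_connect FE (negbT yS)) ->.
rewrite /slot_word big1 // => j _; rewrite no_links ?yS // /sketches /sketch.
by rewrite big1 // => e; rewrite inE.
Qed.

Definition clustering k := iter k (phase E) set0.

Lemma run_program k : S != set0 -> #|slots h reps R| <= 2 ^ (2 ^ k) ->
  exists2 x0, x0 \in S & forall nodes,
  (forall x, x \in S -> [/\ name (nodes x) = x, links (nodes x) = incident E x
    & known (nodes x) = set0]) -> forall x, x \in S ->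
  conclude (run S nodes (program k.+1) x) =
  let g := seed_of (tape (nodes x0)) in
  forest_of (boruvka g (cut_readings E g) (clustering k.+1) R).
Proof.
move=> S0 slots_le; have [x0 x0S lead] := run_tape S0; exists x0 => // nodes init x xS.
have /(run_words (phases_sub E k.+1))/(_ x xS) := run_phases k.+1 (sub0set E) (lead _ init).
rewrite /program -[_ :: _ ++ _]/([:: round_tape] ++ (_ ++ _)) !run_cat.
case=> sc sF sw; rewrite /conclude sc sF /=; congr forest_of.
apply: eq_boruvka => r U clU q.
rewrite -(gather_comp_word _ r sE _ clU); last first.
  by move=> y oy; apply: leq_trans slots_le _; exact: phases_large.
by apply: eq_bigr => y _; exact: sw.
Qed.

End Run.
End Algorithm.

(** * Parameters *)

Lemma mu_leV (T : finType) (A : pred T) q : (0 < q)%N ->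
  (mu A <= q%:R^-1)%R -> #|A| * q <= #|T|.
Proof.
move=> q0; have [T0|T0] := posnP #|T|.
  by move=> _; have := max_card A; rewrite T0 leqn0 => /eqP->.
rewrite /mu ler_pdivrMr ?ltr0n // mulrC ler_pdivlMr ?ltr0n //.
by rewrite -natrM ler_nat.
Qed.

Lemma mu_geV (T : finType) (A : pred T) q : (0 < q)%N ->
  #|A| * q <= #|T| -> (mu A <= q%:R^-1)%R.
Proof.
move=> q0; have [T0|T0] := posnP #|T|.
  by rewrite /mu T0 invr0 mulr0 invr_ge0 ler0n.
move=> le; rewrite /mu ler_pdivrMr ?ltr0n // mulrC ler_pdivlMr ?ltr0n //.
by rewrite -natrM ler_nat.
Qed.

Section Table.
Variable d : nat.

Definition identifier : finType := d.-tuple bool.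
(** Derandomization asks for [2 * h * M] table entries, which is [2 ^ (3 * d + 2)] for
    [h = 2 ^ d.+1] and [M = 2 ^ (2 * d)]. *)
Definition code : finType := (3 * d + 2).-tuple bool.

(** There are at most [2 ^ levels] pairs. The other two parameters push the collision and isolation
    failures of one decoding below [2 ^ -(3 * d + 3)] each. *)
Notation levels := (2 * d).
Notation width := (7 * d + 9).
Notation tries := (8 * (3 * d + 3)).

Definition seed_type := seeds identifier levels width tries d.+1.

Lemma card_identifier : #|identifier| = 2 ^ d.
Proof. by rewrite card_tuple card_bool. Qed.

Lemma card_pairs : #|pairs identifier| <= 2 ^ levels.
Proof.
rewrite card_draws card_identifier bin2 mul2n -addnn expnD.
apply: leq_trans (half_leq (leq_mul (leqnn _) (leq_pred _))) _.
by rewrite leq_half_double -addnn -addnS leq_addr.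
Qed.

Lemma failure_bound :
  ((d.+1 * 2 ^ d)%:R *
    ((tries * levels.+1 * #|pairs identifier|)%:R / 2 ^+ width + (7 / 8) ^+ tries)
    <= (2 ^ d.+2)%:R^-1 :> rat)%R.
Proof.
have d2 : d.+1 <= 2 ^ d by exact: ltn_expl.
have RV : d.+1 * 2 ^ d <= 2 ^ (2 * d).
  by rewrite mul2n -addnn expnD leq_mul.
have col : tries * levels.+1 * #|pairs identifier| <= 2 ^ (4 * d + 6).
  rewrite (_ : 4 * d + 6 = 6 + (d + d) + 2 * d); last lia.
  rewrite expnD leq_mul ?card_pairs //.
  rewrite !expnD; move: (2 ^ d) d2 => n; nia.
pose x : rat := (2 ^+ (3 * d + 3))^-1.
have b1 : ((tries * levels.+1 * #|pairs identifier|)%:R / 2 ^+ width <= x :> rat)%R.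
  rewrite ler_pdivrMr ?exprn_gt0 // /x (_ : width = (3 * d + 3) + (4 * d + 6)); last lia.
  rewrite [(2 ^+ (_ + (4 * d + 6)))%R]exprD mulKf ?expf_neq0 ?pnatr_eq0 //.
  by rewrite -natrX ler_nat.
have b2 : ((7 / 8) ^+ tries <= x :> rat)%R.
  rewrite exprM /x -exprVn; apply: lerXn2r.
  - by rewrite nnegrE; apply: exprn_ge0; rewrite divr_ge0.
  - by rewrite nnegrE invr_ge0.
  (* Eight tries gain a factor 2, as [(7 / 8) ^ 8 <= 1 / 2]. *)
  - by rewrite !exprS expr0; lra.
apply: (@le_trans _ _ ((2 ^ (2 * d))%:R * (x + x))%R).
  apply: ler_pM; [exact: ler0n| |by rewrite ler_nat|exact: lerD].
  apply: addr_ge0; first by rewrite mulr_ge0 ?invr_ge0 ?exprn_ge0 ?ler0n.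
  by apply: exprn_ge0; rewrite divr_ge0.
rewrite !natrX /x (_ : 3 * d + 3 = (2 * d + d.+2).+1); last lia.
rewrite exprS exprD.
have a0 : (0 < 2 ^+ d.+2 :> rat)%R by rewrite exprn_gt0.
have b0 : (0 < 2 ^+ (2 * d) :> rat)%R by rewrite exprn_gt0.
move: (2 ^+ d.+2)%R (2 ^+ (2 * d))%R a0 b0 => a b a0 b0.
by rewrite le_eqVlt; apply/orP; left; apply/eqP; field; rewrite !gt_eqF.
Qed.

(** There are at most [2 ^ (2 ^ (2 * d))] simple graphs on the identifiers, fewer than [4 ^ M] for
    [M = 2 ^ (2 * d)], and each fails on a fraction at most [2 ^ -(d + 2)] of the seeds. *)
Lemma good_table k : exists f : {ffun code -> seed_type}, forall E, simple_graph E ->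
  #|[pred c | ~~ boruvka_ok E (clustering E k) (f c)]| < 4 * 2 ^ (2 * d).
Proof.
pose bad (E : {set {set identifier}}) : pred seed_type :=
  [pred g | ~~ boruvka_ok E (clustering E k) g].
have [] := @derandomize _ seed_type code (powerset (pairs identifier)) bad
  (2 ^ (2 * d)) (2 ^ d.+1).
- by rewrite expn_gt0.
- by rewrite !card_ffun !expn_gt0 draw_gt0.
- by rewrite card_tuple card_bool -expnS -expnD; congr (_ ^ _); lia.
- rewrite card_powerset (_ : 4 = 2 ^ 2) // -expnM ltn_exp2l //.
  apply: leq_ltn_trans card_pairs _.
  by rewrite ltn_Pmull ?expn_gt0.
- move=> E; rewrite powersetE => /subsetP sE; rewrite -expnS; apply: mu_leV.
    by rewrite expn_gt0.
  have {}sE : simple_graph E by move=> e /sE; rewrite inE => /eqP.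
  apply: le_trans (@mu_not_boruvka_ok _ _ _ _ _ _ _ sE card_pairs) _.
  by rewrite card_identifier failure_bound.
move=> f fP; exists f => E sE; apply: fP.
by rewrite powersetE; apply/subsetP => e eE; rewrite inE sE.
Qed.

End Table.

(** * From identifiers back to vertices *)

Lemma forest_ofP (V : finType) (G : {set {set V}}) : spanning G (forest_of G).
Proof.
rewrite /forest_of; case: pickP => //= none.
by have [F GF] := spanning_exists G; rewrite none in GF.
Qed.

Lemma spanning_sub (V : finType) (E G F : {set {set V}}) : G \subset E ->
  same_components E G -> spanning G F -> spanning E F.
Proof.
move=> GE EG /asboolP[FG aF GF]; apply/asboolP; split => //.
  exact: subset_trans FG GE.
by move=> x y; rewrite GF EG.
Qed.

Section Pullback.
Variables (idlen : nat -> nat) (V : finType) (ident : V -> (idlen #|V|).-tuple bool).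
Hypothesis inj : injective ident.
Implicit Types (E F : {set {set V}}).

Local Notation "E ^#" := (edge_ids ident E) (at level 2).

Lemma ident_pair u v : ident @: [set u; v] = [set ident u; ident v].
Proof. by rewrite imsetU !imset_set1. Qed.

Lemma adj_edge_ids E u v : adj E^# (ident u) (ident v) = adj E u v.
Proof.
by rewrite /adj /= -ident_pair /edge_ids mem_imset //; exact: imset_inj.
Qed.

Lemma path_edge_ids E u p : path (adj E^#) (ident u) p ->
  exists2 q, p = map ident q & path (adj E) u q.
Proof.
elim: p u => [|y p IH] u /=; first by exists [::].
move=> /andP[uy]; have /imsetP[e _ ue] := uy.
have /imsetP[v _ yv] : y \in ident @: e by rewrite -ue set22.
move: uy; rewrite yv adj_edge_ids => uv /IH[q -> vq].
by exists (v :: q) => //=; rewrite uv.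
Qed.

Lemma connect_edge_ids E u v :
  connect (adj E^#) (ident u) (ident v) = connect (adj E) u v.
Proof.
apply/connectP/connectP => [[p]|[p up ->]].
  move=> /path_edge_ids[q -> uq]; rewrite last_map => /inj ->.
  by exists q.
by exists (map ident p); rewrite ?last_map // path_map (eq_path (e' := adj E)) //;
  move=> x y; rewrite /= adj_edge_ids.
Qed.

Lemma simple_edge_ids E : simple_graph E -> simple_graph E^#.
Proof. by move=> sE _ /imsetP[e /sE eE ->]; rewrite card_imset. Qed.

(** Since [ident] is injective and every edge of [H] is the image of an edge of [E], cycles and
    connections correspond on both sides. *)
Lemma spanning_pullback E H : spanning E^# H ->
  exists F, maximal_spanning_forest E F /\ F^# = H.
Proof.
move=> /asboolP[HE aH EH]; exists [set e in E | ident @: e \in H].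
set F := finset _.
have FH : F^# = H.
  apply/setP => e; apply/imsetP/idP => [[e' + ->]|eH]; first by rewrite inE => /andP[].
  have /imsetP[e' e'E ee'] := subsetP HE _ eH.
  by exists e' => //; rewrite inE e'E -ee'.
split=> //; split.
  split; first by apply/subsetP => e; rewrite inE => /andP[].
  move=> p sp /andP[cp up]; apply: (aH (map ident p)); first by rewrite size_map.
  apply/andP; split; last by rewrite map_inj_uniq.
  rewrite cycle_map; apply: sub_cycle cp => x y /=.
  by rewrite -FH adj_edge_ids.
apply: eq_n_comp => u v; rewrite -!connect_edge_ids FH; exact: EH.
Qed.

End Pullback.

(** * Correctness *)

Section BitCode.
Variables (T : finType) (x0 : T) (b : nat).

Definition to_bits (x : T) : b.-tuple bool :=
  nth [tuple of nseq b false] (enum {: b.-tuple bool}) (enum_rank x).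

Definition of_bits (y : b.-tuple bool) : T := odflt x0 [pick x | to_bits x == y].

Lemma to_bitsK : #|T| <= 2 ^ b -> cancel to_bits of_bits.
Proof.
move=> Tb x; rewrite /of_bits; case: pickP => [x' /eqP|/(_ x)]; last by rewrite eqxx.
have lt (z : T) : enum_rank z < size (enum {: b.-tuple bool}).
  by rewrite -cardE card_tuple card_bool; exact: leq_trans (ltn_ord _) Tb.
by move/eqP; rewrite /to_bits nth_uniq ?enum_uniq ?lt // => /eqP/ord_inj/enum_rank_inj.
Qed.

End BitCode.

(** * The algorithm and its success probability *)

Section Conn.
Variable idlen : nat -> nat.

Definition depth d := up_log 2 (up_log 2 #|slots (2 * d) (8 * (3 * d + 3)) d.+1|).

Lemma slots_depth d : #|slots (2 * d) (8 * (3 * d + 3)) d.+1| <= 2 ^ (2 ^ depth d).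
Proof.
apply: leq_trans (up_logP _ (isT : 1 < 2)) _; rewrite leq_pexp2l //.
exact: up_logP.
Qed.

(** Local computation being unrestricted, a table obtained by choice can be built into every
    node. *)
Definition table d := sval (cid (good_table d (depth d).+1)).

Definition message d : finType := msg (identifier d) (code d) (7 * d + 9).

Lemma card_message d : #|message d| <= 2 ^ (12 * d + 12).
Proof.
rewrite !card_prod card_option card_prod card_tuple card_bool card_word card_tuple card_bool.
(* The optional edge takes [2 * d + 1] bits, the word [7 * d + 9] and the table index
   [3 * d + 2]. *)
rewrite (_ : 12 * d + 12 = (2 * d + 1) + (7 * d + 9) + (3 * d + 2)); last lia.
rewrite !expnD leq_mul // leq_mul // expn0 expn1.
by have := expn_gt0 2 d; move: (2 ^ d) => a; nia.
Qed.

Definition message0 d : message d := (None, 0%R, [tuple of nseq _ false]).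

Definition start d (x : identifier d) edges (c : code d) :
  local (identifier d) (code d) (7 * d + 9) :=
  Local x edges c set0 [ffun => None].

Definition conn_rounds d := size (program (table d) (depth d).+1).

Definition conn_width n := 12 * idlen n + 12.
Definition conn_coins n := 3 * idlen n + 2.
Definition conn_local n := local (identifier (idlen n)) (code (idlen n)) (7 * idlen n + 9).
Definition conn_message n := message (idlen n).
Definition conn_enc n : conn_message n -> (conn_width n).-tuple bool := @to_bits _ _.
Definition conn_dec n : (conn_width n).-tuple bool -> conn_message n :=
  @of_bits _ (message0 _) _.
Definition conn_start n (x : (idlen n).-tuple bool) edges (c : (conn_coins n).-tuple bool) :
  conn_local n := start x edges c.
Definition conn_program n := program (table (idlen n)) (depth (idlen n)).+1.
Definition conn_result n (s : conn_local n) := conclude (table (idlen n)) s.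

Definition conn : cc_algorithm idlen :=
  compile conn_enc conn_dec conn_start conn_program conn_result.

Section Correct.
Variables (V : finType) (E : {set {set V}}) (ident : V -> (idlen #|V|).-tuple bool).
Hypotheses (V0 : 0 < #|V|) (sE : simple_graph E) (inj : injective ident).

Local Notation d := (idlen #|V|).
Local Notation E' := (edge_ids ident E).

Lemma incident_edge_ids v : incident E' (ident v) = edge_ids ident (incident_edges E v).
Proof.
apply/setP => e; rewrite inE; apply/andP/imsetP => [[/imsetP[e' e'E ->]]|[e' + ->]].
  by rewrite mem_imset // => ve'; exists e'; rewrite ?inE ?e'E.
by rewrite inE => /andP[e'E ve']; rewrite !imset_f.
Qed.

Lemma conn_leader : exists v0 : V, forall r : randomness conn V,
  boruvka_ok E' (clustering E' (depth d).+1) (table d (r v0)) ->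
  solves_connectivity ident E (conn_rounds d) r.
Proof.
pose S := [set ident v | v : V].
have ES e : e \in E' -> e \subset S.
  by move=> /imsetP[e' _ ->]; apply: imsetS; apply/subsetP.
have S0 : S != set0.
  by have /card_gt0P[v _] := V0; apply/set0Pn; exists (ident v); rewrite imset_f.
have sE' := simple_edge_ids inj sE.
have [x0 /imsetP[v0 _ ->] lead] :=
  @run_program _ _ _ _ _ _ (table d) S E' sE' ES _ S0 (slots_depth d).
exists v0 => r ok.
(* The abstract run needs states at all identifiers, so those without a node get dummy coins. *)
pose tape_of x : code d := oapp r [tuple of nseq _ false] [pick v | ident v == x].
pose L0 x := start x (incident E' x) (tape_of x).
have tapeE v : tape_of (ident v) = r v.
  rewrite /tape_of; case: pickP => [v' /eqP/inj-> //|/(_ v)]; by rewrite eqxx.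
have L0E v : L0 (ident v) = start (ident v) (edge_ids ident (incident_edges E v)) (r v).
  by rewrite /L0 tapeE incident_edge_ids.
pose g := table d (r v0).
pose G := boruvka g (cut_readings E' g) (clustering E' (depth d).+1) d.+1.
have sub := phases_sub E' (depth d).+1.
have [|F [maxF FE]] := @spanning_pullback _ _ ident inj E (forest_of G).
  apply: (spanning_sub (boruvka_ok_sub _ sub ok)); last exact: forest_ofP.
  by apply: boruvka_connect ok; rewrite // card_identifier ltn_exp2l.
exists F; split; first by [].
move=> v; rewrite FE.
have encK n : cancel (@conn_enc n) (@conn_dec n) by exact/to_bitsK/card_message.
have cfg := @config_run _ _ _ _ _ _ _
  conn_start conn_program conn_result _ _ _ r L0 encK inj L0E _ _
  (esym (cats0 (conn_program #|V|))) v.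
transitivity (conclude (table d) (run S L0 (program (table d) (depth d).+1) (ident v))).
  exact: (congr1 (fun s : node _ _ _ _ => conn_result s.2) cfg).
rewrite lead; [by rewrite /= tapeE|by []|by rewrite imset_f].
Qed.

Lemma conn_correct (R : realType) :
  (1 - 1 / #|V|%:R <= uniform_prob R
    (@solves_connectivity idlen conn V ident E (conn_rounds d)))%R.
Proof.
have [v0 lead] := conn_leader.
pose bad : pred (code d) := fun c => ~~ boruvka_ok E' (clustering E' (depth d).+1) (table d c).
have code0 : 0 < #|code d| by rewrite card_tuple card_bool expn_gt0.
have Vd : #|V| <= 2 ^ d.
  by rewrite -[X in _ <= X](card_identifier d); exact: leq_card inj.
have badc : #|bad| * #|V| <= #|code d|.
  (* Fewer than [4 * 2 ^ (2 * d)] of the [2 ^ (3 * d + 2)] indices are bad, a fraction below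
     [2 ^ -d], itself at most [1 / #|V|]. *)
  have lt := svalP (cid (good_table d (depth d).+1)) _ (simple_edge_ids inj sE).
  apply: leq_trans (leq_mul (ltnW lt) Vd) _.
  rewrite card_tuple card_bool (_ : 4 = 2 ^ 2) // -!expnD leq_pexp2l //; lia.
have {badc} : #|[pred r : randomness conn V | bad (r v0)]| * #|V| <= #|randomness conn V|.
  apply: mu_leV => //; apply: le_trans (mu_coord v0 bad code0) _; exact: mu_geV.
rewrite /uniform_prob; set N := #|randomness conn V|; set b := #|_|; set a := #|_| => bN.
have N0 : 0 < N by rewrite /N card_ffun expn_gt0 code0.
have Nab : N <= a + b.
  rewrite /N -(cardC [pred r : randomness conn V | bad (r v0)]) addnC leq_add2r.
  apply/subset_leq_card/subsetP => r; rewrite !inE => /negPn ok.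
  by apply/asboolP; exact: lead.
rewrite ler_pdivlMr ?ltr0n // mulrBl !mul1r lerBlDr.
have bV : (b%:R <= #|V|%:R^-1 * N%:R :> R)%R.
  by rewrite mulrC ler_pdivlMr ?ltr0n // -natrM ler_nat.
apply: (@le_trans _ _ (a%:R + b%:R)%R); last by rewrite lerD2l.
by rewrite -natrD ler_nat.
Qed.

End Correct.
End Conn.

(** * Asymptotics *)

(** The number of slots is at most [2 ^ 6 * d.+1 ^ 3], so its logarithm is at most [6 + 3 * u],
    which is below [8 * u.+1]. *)
Lemma conn_rounds_le d : conn_rounds d <= 15 + 3 * up_log 2 (up_log 2 d.+1).+1.
Proof.
rewrite /conn_rounds size_program.
suff : depth d <= 3 + up_log 2 (up_log 2 d.+1).+1 by lia.
set u := up_log 2 d.+1; apply: up_log_min => //.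
have uv : u.+1 <= 2 ^ up_log 2 u.+1 by exact: up_logP.
rewrite expnD; apply: leq_trans (leq_mul (leqnn _) uv).
apply: (@leq_trans (6 + 3 * u)); last by lia.
apply: up_log_min => //.
rewrite (_ : 2 ^ (6 + 3 * u) = (2 ^ u) ^ 3 * 2 ^ 6); last first.
  by rewrite addnC mulnC expnD expnM.
have du : d.+1 <= 2 ^ u by exact: up_logP.
rewrite !card_prod !card_ord.
apply: (@leq_trans (d.+1 ^ 3 * 2 ^ 6)); last first.
  by apply: leq_mul; [exact: leq_expn2r|].
by rewrite !expnS expn0; lia.
Qed.

(* Imported only here: it shadows names of finset such as [set0]. *)
From mathcomp Require Import classical_sets.

Local Open Scope classical_set_scope.
Local Open Scope ring_scope.

Section Asymptotics.
Variable R : realType.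
Implicit Types x : R.

(** This is [ln (1 + x) <= x] at [x = - 1 / 2]. *)
Lemma ln2_ge : 1 / 2 <= ln 2 :> R.
Proof.
have := @le_ln1Dx R (- (1 / 2)); rewrite (_ : 1 + - (1 / 2) = 2^-1); last by field.
by rewrite lnV ?posrE // => /(_ _); lra.
Qed.

Lemma le_ln_expR (a x : R) : expR a <= x -> a <= ln x.
Proof.
move=> ax; have x0 := lt_le_trans (expR_gt0 a) ax.
by rewrite -[a]expRK ler_ln ?posrE ?expR_gt0.
Qed.

(** The factor 2 comes from [ln 2 >= 1 / 2], the summand 1 from rounding up. *)
Lemma up_log_ln n : (0 < n)%N -> (up_log 2 n)%:R <= 2 * ln n%:R + 1 :> R.
Proof.
move=> n0; have [n1|n1] := leqP n 1%N.
  by rewrite (_ : n = 1%N) ?up_log1 ?ln1; [lra|lia].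
have := up_log_gtn (isT : 1 < 2)%N n1.
have : (0 < up_log 2 n)%N by rewrite up_log_gt0.
case: (up_log 2 n) => // u _ /=; rewrite -(ltr_nat R) natrX => lt.
have : ln (2 ^+ u) <= ln n%:R :> R by rewrite ler_ln ?posrE ?ltr0n ?exprn_gt0 // ltW.
rewrite lnXn // -[_ *+ u]mulr_natl -[u.+1%:R]natr1 => le.
have := ler_wpM2l (ler0n R u) ln2_ge; lra.
Qed.

Lemma ln3_large (K : R) : \forall n \near \oo, K <= ln (ln (ln n%:R)).
Proof.
near=> n; do 3 apply: le_ln_expR.
near: n; exact: nbhs_infty_ger.
Unshelve. all: by end_near. Qed.

Variable idlen : nat -> nat.
Hypothesis idlenO : (fun n : nat => (idlen n)%:R : R^o) =O_\oo
  (fun n : nat => ln n%:R : R^o).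

Lemma idlen_le : exists2 c : R,
  1 <= c & \forall n \near \oo, (idlen n)%:R + 1 <= c * ln n%:R.
Proof.
have /eqO_exP[k k0 kn] := idlenO; exists (k + 1); first by lra.
near=> n.
have : `|(idlen n)%:R : R| <= k * `|ln n%:R|; first by near: n.
have : 1 <= ln n%:R :> R by apply: le_ln_expR; near: n; exact: nbhs_infty_ger.
by rewrite ger0_norm // => l1; rewrite ger0_norm; nra.
Unshelve. all: by end_near. Qed.

Lemma widthO : (fun n : nat => (conn_width idlen n)%:R : R^o) =O_\oo
  (fun n : nat => ln n%:R : R^o).
Proof.
have [c c1 cn] := idlen_le; apply/eqO_exP; exists (12 * c); first by lra.
near=> n.
have le : (idlen n)%:R + 1 <= c * ln n%:R by near: n.
have l1 : 1 <= ln n%:R :> R by apply: le_ln_expR; near: n; exact: nbhs_infty_ger.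
rewrite !ger0_norm //; last by lra.
by rewrite /conn_width natrD natrM; lra.
Unshelve. all: by end_near. Qed.

Lemma roundsO : (fun n : nat => (conn_rounds (idlen n))%:R : R^o) =O_\oo
  (fun n : nat => ln (ln (ln n%:R)) : R^o).
Proof.
have [c c1 cn] := idlen_le; apply/eqO_exP; exists 30; first by lra.
have lc0 : 0 <= ln c by exact: ln_ge0.
near=> n.
have le : (idlen n)%:R + 1 <= c * ln n%:R by near: n.
(* This threshold absorbs [c] and every additive constant below. *)
have l3 : 5 + ln c <= ln (ln (ln n%:R)) by near: n; exact: ln3_large.
move: le l3; set L := ln n%:R; set l := ln L => le l3.
(* Since [ln] is 0 on nonpositive arguments, a positive logarithm certifies a positive argument. *)
have pos x : 0 < ln x -> 0 < x by move=> lx; rewrite ltNge; apply/negP => /ln0; lra.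
have l0 : 0 < l by apply: pos; lra.
have L0 : 0 < L by exact: pos.
have c0 : 0 < c by lra.
have ll : ln l <= l by apply/ltW/ln_sublinear.
rewrite [leRHS]mulrC !ger0_norm //; last by lra.
set u := up_log 2 (idlen n).+1.
have u1 : u.+1%:R <= 5 * l.
  have := @up_log_ln (idlen n).+1 isT; rewrite -/u -[(idlen n).+1%:R]natr1 => ub.
  have : ln ((idlen n)%:R + 1) <= ln c + l.
    by rewrite -lnM ?posrE // ler_ln ?posrE ?mulr_gt0 // ltr_wpDl.
  rewrite -[u.+1%:R]natr1; lra.
have u2 : ln u.+1%:R <= 5 + ln l.
  apply: (@le_trans _ _ (ln 5 + ln l)); last first.
    by rewrite lerD2r; apply/ltW/ln_sublinear.
  by rewrite -lnM ?posrE // ler_ln ?posrE ?ltr0n // mulr_gt0.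
have := conn_rounds_le (idlen n); rewrite -(ler_nat R) natrD natrM -/u => Tb.
have := @up_log_ln u.+1 isT; lra.
Unshelve. all: by end_near. Qed.

End Asymptotics.

Theorem theorem20 (R : realType) (idlen : nat -> nat)
    (idlenO : (fun n : nat => (idlen n)%:R : R^o) =O_\oo
              (fun n : nat => ln n%:R : R^o)) :
  exists (A : cc_algorithm idlen) (T : nat -> nat),
    [/\ (fun n : nat => (bandwidth A n)%:R : R^o) =O_\oo
          (fun n : nat => ln n%:R : R^o),
        (fun n : nat => (T n)%:R : R^o) =O_\oo
          (fun n : nat => ln (ln (ln n%:R)) : R^o) &
        forall (V : finType) (E : {set {set V}})
               (ident : V -> (idlen #|V|).-tuple bool),
          (0 < #|V|)%N -> simple_graph E -> injective ident ->
          1 - 1 / #|V|%:R <=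
            uniform_prob R (@solves_connectivity idlen A V ident E (T #|V|))].
Proof.
exists (conn idlen), (fun n => conn_rounds (idlen n)); split.
- exact: widthO.
- exact: roundsO.
- by move=> V E ident V0 sE inj; exact: conn_correct.
Qed.
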